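(* There is an algorithm which, given any convex $n$-gon $C$ with $n \ge 5$ (by the coordinates of its vertices $p_1,\dots,p_n$ in counterclockwise order), finds a minimum perimeter convex polygon inscribed in $C$ in $O(n^3)$ steps.
   Context: A convex polygon $Q$ is inscribed in a convex polygon $C$ if every side of $C$ contains at least one vertex of $Q$. Set $p(C)=\inf\{\operatorname{perim}(Q) : Q \text{ is inscribed in } C\}$. A minimum perimeter convex polygon inscribed in $C$ is a convex polygon $Q$ inscribed in $C$ with $\operatorname{perim}(Q)=p(C)$. Sides of polygons are closed segments. Steps are elementary operations on real numbers (arithmetic operations, square roots and comparisons), each of unit cost. *)

(* Defs.v *)
From HB Require Import structures.
From mathcomp Require Import all_boot all_order all_algebra.
From mathcomp Require Import classical_sets reals.
Set Implicit Arguments.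
Unset Strict Implicit.
Unset Printing Implicit Defensive.
Import Order.TTheory GRing.Theory Num.Theory.
Local Open Scope ring_scope.

Section Polygons.
Variable R : realType.
Implicit Types (a b c x : R * R) (C Q : seq (R * R)).

Definition dist a b : R :=
  Num.sqrt ((b.1 - a.1) ^+ 2 + (b.2 - a.2) ^+ 2).

Definition orient a b c : R :=
  (b.1 - a.1) * (c.2 - a.2) - (b.2 - a.2) * (c.1 - a.1).

Definition segment a b x : Prop :=
  exists2 t : R, 0 <= t <= 1 &
    x = (a.1 + t * (b.1 - a.1), a.2 + t * (b.2 - a.2)).

(* Vertices are indexed from 0, cyclically. *)
Definition vertex C (i : nat) : R * R := nth (0, 0) C (i %% size C).

Definition side C (i : nat) : R * R -> Prop :=
  segment (vertex C i) (vertex C i.+1).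

(* [C] lists the vertices of a convex polygon in counterclockwise order: every
   other vertex lies strictly to the left of each directed side.  In particular
   the vertices are distinct, no angle is flat, the polygon winds once, and
   the polygon has nonempty interior. *)
Definition convex_polygon C : Prop :=
  (3 <= size C)%N /\
  forall i k : nat, (i < size C)%N -> (k < size C)%N ->
    k != i -> k != (i.+1 %% size C)%N ->
    0 < orient (vertex C i) (vertex C i.+1) (vertex C k).

Definition perim C : R :=
  \sum_(i < size C) dist (vertex C i) (vertex C i.+1).

(* Containment of [Q] in [C] is not required. *)
Definition inscribed Q C : Prop :=
  [/\ convex_polygon Q, convex_polygon C &
      forall i : nat, (i < size C)%N -> exists2 x, x \in Q & side C i x].

(* For convex [C] this is an infimum of a nonempty set (it contains [perim C])
   bounded below by 0, so the default value of [inf] is not involved. *)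
Definition min_perim C : R :=
  inf [set perim Q | Q in [set Q | inscribed Q C]]%classic.

Definition min_perim_inscribed Q C : Prop :=
  inscribed Q C /\ perim Q = min_perim C.

End Polygons.

(* Algorithms are programs of a real RAM.  A program is a finite text that does
   not depend on the input.  It works on finitely many named arrays of natural
   numbers, used for indices and counters, and finitely many named arrays of
   reals; each array is unbounded and addressed by index expressions.  The only
   operations on reals are the four arithmetic operations, square root and
   comparison, and the only real constants are natural numbers; reals cannot be
   converted to indices.  Index arithmetic is restricted to addition and
   truncated subtraction. *)
Inductive nexpr : Type :=
  | NConst of nat
  | NGet of nat & nexpr
  | NAdd of nexpr & nexpr
  | NSub of nexpr & nexpr.

Inductive rexpr : Type :=
  | RConst of nat
  | RGet of nat & nexpr
  | RAdd of rexpr & rexpr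
  | RSub of rexpr & rexpr
  | RMul of rexpr & rexpr
  | RDiv of rexpr & rexpr
  | RSqrt of rexpr.

Inductive bexpr : Type :=
  | NLe of nexpr & nexpr
  | RLe of rexpr & rexpr
  | BNot of bexpr
  | BAnd of bexpr & bexpr.

(* [NSet a i e] and [RSet a i e] store [e] in cell [i] of array [a]. *)
Inductive cmd : Type :=
  | Skip
  | NSet of nat & nexpr & nexpr
  | RSet of nat & nexpr & rexpr
  | Seq of cmd & cmd
  | If of bexpr & cmd & cmd
  | While of bexpr & cmd.

(* The cost of evaluating an expression is its number of nodes: constants,
   memory accesses, index operations and real operations all have unit cost. *)
Fixpoint ncost (e : nexpr) : nat :=
  match e with
  | NConst _ => 1
  | NGet _ i => (ncost i).+1
  | NAdd e1 e2 | NSub e1 e2 => (ncost e1 + ncost e2).+1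
  end.

Fixpoint rcost (e : rexpr) : nat :=
  match e with
  | RConst _ => 1
  | RGet _ i => (ncost i).+1
  | RAdd e1 e2 | RSub e1 e2 | RMul e1 e2 | RDiv e1 e2 =>
      (rcost e1 + rcost e2).+1
  | RSqrt e1 => (rcost e1).+1
  end.

Fixpoint bcost (b : bexpr) : nat :=
  match b with
  | NLe e1 e2 => (ncost e1 + ncost e2).+1
  | RLe e1 e2 => (rcost e1 + rcost e2).+1
  | BNot b1 => (bcost b1).+1
  | BAnd b1 b2 => (bcost b1 + bcost b2).+1
  end.

Section Semantics.
Variable R : realType.

Record state : Type := State {
  nmem : nat -> nat -> nat;
  rmem : nat -> nat -> R
}.

Definition update (T : Type) (m : nat -> nat -> T) (a i : nat) (v : T) :
    nat -> nat -> T :=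
  fun b j => if (b == a) && (j == i) then v else m b j.

Fixpoint neval (s : state) (e : nexpr) : nat :=
  match e with
  | NConst k => k
  | NGet a i => nmem s a (neval s i)
  | NAdd e1 e2 => (neval s e1 + neval s e2)%N
  | NSub e1 e2 => (neval s e1 - neval s e2)%N
  end.

(* Division by 0 and the square root of a negative number return 0, as in the
   library; a program can test for these cases by a comparison, so the
   convention adds no power. *)
Fixpoint reval (s : state) (e : rexpr) : R :=
  match e with
  | RConst k => k%:R
  | RGet a i => rmem s a (neval s i)
  | RAdd e1 e2 => reval s e1 + reval s e2
  | RSub e1 e2 => reval s e1 - reval s e2
  | RMul e1 e2 => reval s e1 * reval s e2
  | RDiv e1 e2 => reval s e1 / reval s e2
  | RSqrt e1 => Num.sqrt (reval s e1)
  end.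

Fixpoint beval (s : state) (b : bexpr) : bool :=
  match b with
  | NLe e1 e2 => (neval s e1 <= neval s e2)%N
  | RLe e1 e2 => reval s e1 <= reval s e2
  | BNot b1 => ~~ beval s b1
  | BAnd b1 b2 => beval s b1 && beval s b2
  end.

(* [exec P s t s']: started in [s], the program [P] halts in state [s'] after
   exactly [t] steps. *)
Inductive exec : cmd -> state -> nat -> state -> Prop :=
  | ExecSkip s : exec Skip s 1 s
  | ExecNSet s a i e :
      exec (NSet a i e) s (ncost i + ncost e).+1
        (State (update (nmem s) a (neval s i) (neval s e)) (rmem s))
  | ExecRSet s a i e :
      exec (RSet a i e) s (ncost i + rcost e).+1
        (State (nmem s) (update (rmem s) a (neval s i) (reval s e)))
  | ExecSeq s s1 s2 P1 P2 t1 t2 :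
      exec P1 s t1 s1 -> exec P2 s1 t2 s2 ->
      exec (Seq P1 P2) s (t1 + t2) s2
  | ExecIfTrue s s' b P1 P2 t :
      beval s b -> exec P1 s t s' ->
      exec (If b P1 P2) s (bcost b + t).+1 s'
  | ExecIfFalse s s' b P1 P2 t :
      ~~ beval s b -> exec P2 s t s' ->
      exec (If b P1 P2) s (bcost b + t).+1 s'
  | ExecWhileFalse s b P :
      ~~ beval s b -> exec (While b P) s (bcost b).+1 s
  | ExecWhileTrue s s1 s2 b P t1 t2 :
      beval s b -> exec P s t1 s1 -> exec (While b P) s1 t2 s2 ->
      exec (While b P) s (bcost b + t1 + t2).+1 s2.

(* Programs are deterministic, so a halting run is the only run. *)
Lemma exec_det P s t1 s1 t2 s2 :
  exec P s t1 s1 -> exec P s t2 s2 -> t1 = t2 /\ s1 = s2.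
Proof.
move=> E1; elim: E1 t2 s2 => {P s t1 s1}.
- by move=> s t2 s2 E; inversion E.
- by move=> s a i e t2 s2 E; inversion E.
- by move=> s a i e t2 s2 E; inversion E.
- move=> s s1 s2 P1 P2 t1 t2 _ IH1 _ IH2 t s' E.
  inversion E as [| | |? u ? ? ? ? ? E1 E2| | | |]; subst.
  have [? ?] := IH1 _ _ E1; subst.
  by have [? ?] := IH2 _ _ E2; subst.
- move=> s s' b P1 P2 t bT _ IH t2 s2 E.
  inversion E as [| | | |? ? ? ? ? ? b' E1|? ? ? ? ? ? b' E1| |]; subst.
    by have [? ?] := IH _ _ E1; subst.
  by rewrite bT in b'.
- move=> s s' b P1 P2 t bF _ IH t2 s2 E.
  inversion E as [| | | |? ? ? ? ? ? b' E1|? ? ? ? ? ? b' E1| |]; subst.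
    by rewrite b' in bF.
  by have [? ?] := IH _ _ E1; subst.
- move=> s b P bF t2 s2 E.
  inversion E as [| | | | | | |? ? ? ? ? ? ? b']; subst => //.
  by rewrite b' in bF.
- move=> s s1 s2 b P t1 t2 bT _ IH1 _ IH2 t s' E.
  inversion E as [| | | | | |? ? ? b'|? ? ? ? ? ? ? b' E1 E2]; subst.
    by rewrite bT in b'.
  have [? ?] := IH1 _ _ E1; subst.
  by have [? ?] := IH2 _ _ E2; subst.
Qed.

(* A polygon is stored as its number of vertices, in cell 0 of index array 0,
   and the coordinates of its vertices, in real arrays 0 and 1.  This layout is
   used for input and output; all other cells are initially 0. *)
Definition input (C : seq (R * R)) : state := State
  (fun a i => if (a == 0%N) && (i == 0%N) then size C else 0%N)
  (fun a i => if a == 0%N then (nth (0, 0) C i).1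
              else if a == 1%N then (nth (0, 0) C i).2 else 0).

Definition output (s : state) : seq (R * R) :=
  [seq (rmem s 0%N i, rmem s 1%N i) | i <- iota 0 (nmem s 0%N 0%N)].

End Semantics.

(* Main.v *)
Require Import Defs.
From mathcomp Require Import all_boot all_order all_algebra.
From mathcomp Require Import classical_sets reals.
From mathcomp Require Import boolp functions topology normedtype derive realfun.
From mathcomp Require Import zify ring lra.
Set Implicit Arguments.
Unset Strict Implicit.
Unset Printing Implicit Defensive.
Import Order.TTheory GRing.Theory Num.Theory.
Import numFieldNormedType.Exports.

(* An inscribed polygon is at least as long as a closed path with one vertex x_i
   on each side [p_i, p_(i+1)] of C, and deleting repetitions from a shortest such
   path gives an inscribed convex polygon, so the task is to minimize
   |x_0 - x_1| + ... + |x_(n-1) - x_0|, a convex function of the positions of the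
   x_i.  Go round C twice: by convexity, averaging the two rounds of a shortest
   path of 2n points gives a shortest path of n points.  Some shortest path with
   2n points goes through a vertex of C, since a path that avoids all vertices
   satisfies the reflection law and, 2n being even, can be translated in a
   one-parameter family of paths of the same length until it meets a vertex.
   Between consecutive visits to vertices p_a and p_b the path obeys the reflection
   law, so it becomes the straight segment from p_a to the image of p_b when C is
   unfolded along the sides between them.  These O(n^2) pieces take O(n) steps each,
   and for each of the O(n) possible starting vertices a dynamic program of O(n^2)
   steps combines them. *)

(** The condition [5 <= n] enters with the deletion of repetitions. No two neighbouring points are
    ever deleted, so at least half of the [n] points survive: three or more for [n >= 5], whereas
    for [n = 4] only two are guaranteed. The translation of a path is not followed until it meets a
    vertex. Instead, among the shortest paths of [2n] points one with the least parameter on side 0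
    is chosen; any translation of equal length that lowers this parameter contradicts the choice.
    The algorithm never decides whether an unfolded segment stays inside the polygons. Clamping
    turns every segment into a feasible path, so each table entry is the length of a genuine path,
    and it is the exact minimum whenever an optimal piece meets no vertex in between. The first fact
    makes the computed path valid, the second makes it optimal. A start may be any [j <= 2n] and the
    path then goes on for [2n] sides, hence the vertices and the table extend to index [4n]. Only
    the values of the dynamic program are compared for each start; the pieces of a path are
    recomputed when it is to be stored, in O(n^2) steps, which the bound allows even if every start
    improves on the previous ones. *)

(** * Plane geometry *)

Section EuclideanPlane.
Local Open Scope ring_scope.
Variable R : realType.
Implicit Types (a b c p q t x : R * R).

Definition hyp (u v : R) : R := Num.sqrt (u ^+ 2 + v ^+ 2).

Lemma distE a b : dist a b = hyp (b.1 - a.1) (b.2 - a.2).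
Proof. by []. Qed.

Lemma hyp_ge0 u v : 0 <= hyp u v.
Proof. exact: sqrtr_ge0. Qed.

Lemma sqr_hyp u v : hyp u v ^+ 2 = u ^+ 2 + v ^+ 2.
Proof. by rewrite sqr_sqrtr // addr_ge0 ?sqr_ge0. Qed.

Lemma hyp0 : hyp 0 0 = 0.
Proof. by rewrite /hyp expr0n addr0 sqrtr0. Qed.

Lemma hyp_eq0 u v : hyp u v = 0 -> u = 0 /\ v = 0.
Proof.
move=> h; have := sqr_hyp u v; rewrite h expr0n /=.
move/esym/eqP; rewrite paddr_eq0 ?sqr_ge0 // !sqrf_eq0.
by move=> /andP[/eqP -> /eqP ->].
Qed.

Lemma hypZ k u v : hyp (k * u) (k * v) = `|k| * hyp u v.
Proof.
rewrite /hyp !exprMn -mulrDr sqrtrM ?sqr_ge0 //.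
by rewrite sqrtr_sqr.
Qed.

Lemma hyp_sqr_eq u v u' v' : u ^+ 2 + v ^+ 2 = u' ^+ 2 + v' ^+ 2 -> hyp u v = hyp u' v'.
Proof. by rewrite /hyp => ->. Qed.

(** Cauchy-Schwarz: the squares of the two sides differ by [(u v' - v u')^2]. *)
Lemma dot_le_hyp u v u' v' : u * u' + v * v' <= hyp u v * hyp u' v'.
Proof.
case: (lerP (u * u' + v * v') 0) => [h|h].
  by apply: le_trans h _; rewrite mulr_ge0 ?hyp_ge0.
rewrite -(@ler_pXn2r _ 2) ?nnegrE ?mulr_ge0 ?hyp_ge0 ?(ltW h) //.
rewrite exprMn !sqr_hyp.
have := sqr_ge0 (u * v' - v * u'); nra.
Qed.

Lemma hypD u v u' v' : hyp (u + u') (v + v') <= hyp u v + hyp u' v'.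
Proof.
rewrite -(@ler_pXn2r _ 2) ?nnegrE ?addr_ge0 ?hyp_ge0 //.
rewrite sqrrD !sqr_hyp.
have := dot_le_hyp u v u' v'; nra.
Qed.

(** Equality in the triangle inequality makes Cauchy-Schwarz sharp, and Lagrange's identity then
    kills the cross product. This is the source of collinearity in [reflection_law]. *)
Lemma hypD_eq u v u' v' :
  hyp (u + u') (v + v') = hyp u v + hyp u' v' -> u * v' = v * u'.
Proof.
move=> h.
have h1 : (u + u') ^+ 2 + (v + v') ^+ 2 = (hyp u v + hyp u' v') ^+ 2.
  by rewrite -h sqr_hyp.
rewrite [RHS]sqrrD !sqr_hyp in h1.
have h2 : u * u' + v * v' = hyp u v * hyp u' v' by nra.
have h3 : (u * u' + v * v') ^+ 2 = (u ^+ 2 + v ^+ 2) * (u' ^+ 2 + v' ^+ 2).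
  by rewrite h2 exprMn !sqr_hyp.
have /eqP : (u * v' - v * u') ^+ 2 = 0.
  by transitivity ((u ^+ 2 + v ^+ 2) * (u' ^+ 2 + v' ^+ 2) - (u * u' + v * v') ^+ 2);
    [ring | rewrite h3 subrr].
by rewrite sqrf_eq0 subr_eq0 => /eqP.
Qed.

Lemma dist_ge0 a b : 0 <= dist a b.
Proof. exact: hyp_ge0. Qed.

Lemma distxx a : dist a a = 0.
Proof. by rewrite distE !subrr hyp0. Qed.

Lemma dist_triangle b a c : dist a c <= dist a b + dist b c.
Proof.
rewrite !distE; apply: le_trans (hypD _ _ _ _).
by rewrite le_eqVlt; apply/orP; left; apply/eqP; congr hyp; ring.
Qed.

Definition on_edge a b (t : R) : R * R :=
  (a.1 + t * (b.1 - a.1), a.2 + t * (b.2 - a.2)).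

Lemma on_edge0 a b : on_edge a b 0 = a.
Proof. by case: a => ? ?; rewrite /on_edge !mul0r !addr0. Qed.

Lemma on_edge1 a b : on_edge a b 1 = b.
Proof. by case: b => ? ?; rewrite /on_edge !mul1r /= ![_ + (_ - _)]addrC !subrK. Qed.

(** Joint convexity of the distance: it reduces global to local minimality in [reflection_law], and
    it justifies averaging the two rounds. *)
Lemma dist_convex a a' b b' (e : R) : 0 <= e <= 1 ->
  dist (on_edge a a' e) (on_edge b b' e) <= (1 - e) * dist a b + e * dist a' b'.
Proof.
move=> /andP[e0 e1]; rewrite !distE /on_edge /=.
have -> : (1 - e) * hyp (b.1 - a.1) (b.2 - a.2) =
    hyp ((1 - e) * (b.1 - a.1)) ((1 - e) * (b.2 - a.2)).
  by rewrite hypZ ger0_norm // subr_ge0.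
have -> : e * hyp (b'.1 - a'.1) (b'.2 - a'.2) =
    hyp (e * (b'.1 - a'.1)) (e * (b'.2 - a'.2)).
  by rewrite hypZ ger0_norm.
apply: le_trans (hypD _ _ _ _).
by rewrite le_eqVlt; apply/orP; left; apply/eqP; congr hyp; ring.
Qed.

Lemma on_edge_edge a b (s t e : R) :
  on_edge (on_edge a b s) (on_edge a b t) e = on_edge a b (s + e * (t - s)).
Proof. by rewrite /on_edge /=; congr (_, _); ring. Qed.

Lemma on_edge_id a (e : R) : on_edge a a e = a.
Proof. by case: a => ? ?; rewrite /on_edge !subrr !mulr0 !addr0. Qed.

Lemma orient_rot a b c : orient a b c = orient b c a.
Proof. by rewrite /orient; ring. Qed.

Lemma orient_anti a b c : orient a b c = - orient a c b.
Proof. by rewrite /orient; ring. Qed.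

Lemma orient_xx a b : orient a a b = 0.
Proof. by rewrite /orient !subrr !mul0r subrr. Qed.

Lemma orient_xyx a b : orient a b a = 0.
Proof. by rewrite /orient !subrr !mulr0 subrr. Qed.

Lemma orient_xyy a b : orient a b b = 0.
Proof. by rewrite /orient; ring. Qed.

Lemma orient_edge a b c d (t : R) :
  orient a b (on_edge c d t) = (1 - t) * orient a b c + t * orient a b d.
Proof. by rewrite /orient /on_edge /=; ring. Qed.

Lemma orient_edge_same a b (t : R) : orient a b (on_edge a b t) = 0.
Proof. by rewrite /orient /on_edge /=; ring. Qed.

(** [k] is twice the parameter, on the line [pq], of the foot of the perpendicular from [t]. *)
Definition mirror p q t : R * R :=
  let k := 2 * ((t.1 - p.1) * (q.1 - p.1) + (t.2 - p.2) * (q.2 - p.2)) /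
           ((q.1 - p.1) * (q.1 - p.1) + (q.2 - p.2) * (q.2 - p.2)) in
  (p.1 + k * (q.1 - p.1) - (t.1 - p.1), p.2 + k * (q.2 - p.2) - (t.2 - p.2)).

Lemma sqr_dist_gt0 p q : p != q ->
  0 < (q.1 - p.1) * (q.1 - p.1) + (q.2 - p.2) * (q.2 - p.2).
Proof.
move=> pq; rewrite lt_neqAle addr_ge0 -?expr2 ?sqr_ge0 // andbT eq_sym.
rewrite paddr_eq0 ?sqr_ge0 // !sqrf_eq0 !subr_eq0; apply: contra pq.
by case: p q => ? ? [? ?] /= /andP[/eqP -> /eqP ->].
Qed.

Lemma orient_mirror p q t : p != q -> orient p q (mirror p q t) = - orient p q t.
Proof.
move=> /sqr_dist_gt0/lt0r_neq0 h; rewrite /orient /mirror /=.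
by field.
Qed.

Lemma dist_mirror p q t s : p != q ->
  dist (on_edge p q s) (mirror p q t) = dist (on_edge p q s) t.
Proof.
move=> /sqr_dist_gt0/lt0r_neq0 h; rewrite !distE /mirror /on_edge /=.
by apply: hyp_sqr_eq; field.
Qed.

(** A reflection is affine and fixes the points of its axis, so it carries a line through such a
    point to a line through the same point with the same parameters. *)
Lemma mirror_edge p q s t k : p != q ->
  mirror p q (on_edge (on_edge p q s) t k) =
  on_edge (on_edge p q s) (mirror p q t) k.
Proof.
move=> /sqr_dist_gt0/lt0r_neq0 h; rewrite /mirror /on_edge /=.
by congr (_, _); field.
Qed.

Lemma on_line p q y : p != q -> orient p q y = 0 -> exists s, y = on_edge p q s.
Proof.
move=> pq oy; have /lt0r_neq0 D0 := sqr_dist_gt0 pq; rewrite /orient in oy.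
exists (((y.1 - p.1) * (q.1 - p.1) + (y.2 - p.2) * (q.2 - p.2)) /
   ((q.1 - p.1) * (q.1 - p.1) + (q.2 - p.2) * (q.2 - p.2))).
case: y oy => y1 y2 /= oy; rewrite /on_edge /=.
set D := (_ + _) in D0 *; congr (_, _); apply: (mulfI D0).
  transitivity (D * p.1 + ((y1 - p.1) * (q.1 - p.1) + (y2 - p.2) * (q.2 - p.2)) * (q.1 - p.1)
    - (q.2 - p.2) * ((q.1 - p.1) * (y2 - p.2) - (q.2 - p.2) * (y1 - p.1))).
    by rewrite /D; ring.
  by rewrite oy mulr0 subr0; field.
transitivity (D * p.2 + ((y1 - p.1) * (q.1 - p.1) + (y2 - p.2) * (q.2 - p.2)) * (q.2 - p.2)
    + (q.1 - p.1) * ((q.1 - p.1) * (y2 - p.2) - (q.2 - p.2) * (y1 - p.1))).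
  by rewrite /D; ring.
by rewrite oy mulr0 addr0; field.
Qed.

Lemma small_step (s s' : R) : 0 < s < 1 ->
  exists2 e, 0 < e <= 1 & 0 <= s + e * (s' - s) <= 1.
Proof.
move=> /andP[s0 s1].
pose d := Num.min s (1 - s).
have d0 : 0 < d by rewrite lt_min s0 subr_gt0.
have dl : d <= s by rewrite ge_min lexx.
have dr : d <= 1 - s by rewrite ge_min lexx orbT.
have w0 := normr_ge0 (s' - s).
have D0 : 0 < d + `|s' - s| by rewrite ltr_wpDr.
exists (d / (d + `|s' - s|)).
  by rewrite divr_gt0 // ler_pdivrMr // mul1r lerDl.
have : `|d / (d + `|s' - s|) * (s' - s)| <= d.
  rewrite normrM ger0_norm ?divr_ge0 ?(ltW d0) ?(ltW D0) //.
  rewrite mulrAC ler_pdivrMr // ler_wpM2l ?(ltW d0) //.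
  by rewrite lerDr (ltW d0).
by rewrite ler_norml => /andP[h1 h2]; lra.
Qed.

(* The path A-x-B has the length of A-x-B' with B' the mirror image of B, and
   it cannot be shortened by moving x towards the point where AB' crosses pq. *)
Lemma reflection_law p q A B s : p != q ->
  0 < orient p q A -> 0 < orient p q B -> 0 < s < 1 ->
  (forall s', 0 <= s' <= 1 ->
     dist A (on_edge p q s) + dist (on_edge p q s) B <=
     dist A (on_edge p q s') + dist (on_edge p q s') B) ->
  let x := on_edge p q s in
  mirror p q B = on_edge A x (1 + orient p q B / orient p q A).
Proof.
move=> pq oA oB s01 hmin x.
set B' := mirror p q B.
have oB' : orient p q B' = - orient p q B by rewrite orient_mirror.
(* The heights of [A] and [B'] over the line [pq] are proportional to [orient p q A] and
   [- orient p q B], so [AB'] crosses that line at this parameter. *)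
pose m := orient p q A / (orient p q A + orient p q B).
have oAB : 0 < orient p q A + orient p q B by rewrite addr_gt0.
have m01 : 0 <= m <= 1.
  by rewrite divr_ge0 ?(ltW oA) ?(ltW oAB) //= ler_pdivrMr // mul1r lerDl ltW.
pose y := on_edge A B' m.
have oy : orient p q y = 0.
  rewrite /y orient_edge oB' /m; field; exact: lt0r_neq0.
have [s' yE] := on_line pq oy.
have disty : dist A y + dist y B = dist A B'.
  have -> : dist y B = dist y B' by rewrite yE dist_mirror.
  have -> : dist A y = m * dist A B'.
    rewrite !distE -[m in RHS]ger0_norm ?(andP m01).1 // -hypZ.
    by congr hyp; rewrite /y /on_edge /=; ring.
  have -> : dist y B' = (1 - m) * dist A B'.
    rewrite !distE -[1 - m]ger0_norm ?subr_ge0 ?(andP m01).2 // -hypZ.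
    by congr hyp; rewrite /y /on_edge /=; ring.
  by ring.
(* The crossing point [y] may lie beyond the ends of the side, where minimality says nothing. A gain
   at [y] would by convexity give a gain after a small step from [x] towards [y], and that step
   stays on the side. *)
have hle : dist A x + dist x B' <= dist A B'.
  have -> : dist x B' = dist x B by rewrite dist_mirror.
  rewrite -disty leNgt; apply/negP => hlt.
  have [e /andP[e0 e1] he] := small_step s' s01.
  have := hmin _ he; rewrite -on_edge_edge -yE -/x leNgt => /negP; apply.
  have c1 := @dist_convex A A x y e; have c2 := @dist_convex x y B B e.
  rewrite !on_edge_id in c1 c2.
  have e01 : 0 <= e <= 1 by rewrite ltW.
  move: (c1 e01) (c2 e01) => {}c1 {}c2.
  have : e * (dist A y + dist y B) < e * (dist A x + dist x B) by rewrite ltr_pM2l.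
  lra.
have heq : dist A B' = dist A x + dist x B'.
  by apply/eqP; rewrite eq_le hle dist_triangle.
have cr : (x.1 - A.1) * (B'.2 - x.2) = (x.2 - A.2) * (B'.1 - x.1).
  apply: hypD_eq; rewrite -!distE -heq distE; congr hyp; ring.
have ox : orient p q x = 0 by rewrite orient_edge_same.
have oAE : orient p q A = (q.1 - p.1) * (A.2 - p.2) - (q.2 - p.2) * (A.1 - p.1) by [].
rewrite [LHS]/orient in oB'; rewrite /orient in ox.
move: {hmin disty m m01 y oy yE s' oAB hle heq} (orient p q A) (orient p q B) oA oB oB' ox oAE.
move=> oA oB oA0 oB0 oB'E ox0 oAE.
have oAn := lt0r_neq0 oA0.
(* B' - x and (oB / oA) (x - A) have the same products with x - A and q - p *)
have h1 : oA * (B'.1 - x.1) = oB * (x.1 - A.1).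
  rewrite oAE -[oB]opprK -oB'E.
  apply/eqP; rewrite -subr_eq0; apply/eqP.
  transitivity ((q.1 - p.1) * ((x.1 - A.1) * (B'.2 - x.2) - (x.2 - A.2) * (B'.1 - x.1))
    + ((q.1 - p.1) * (x.2 - p.2) - (q.2 - p.2) * (x.1 - p.1)) * (B'.1 - A.1)).
    by ring.
  by rewrite cr ox0; ring.
have h2 : oA * (B'.2 - x.2) = oB * (x.2 - A.2).
  rewrite oAE -[oB]opprK -oB'E.
  apply/eqP; rewrite -subr_eq0; apply/eqP.
  transitivity ((q.2 - p.2) * ((x.1 - A.1) * (B'.2 - x.2) - (x.2 - A.2) * (B'.1 - x.1))
    + ((q.1 - p.1) * (x.2 - p.2) - (q.2 - p.2) * (x.1 - p.1)) * (B'.2 - A.2)).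
    by ring.
  by rewrite cr ox0; ring.
have f1 : B'.1 = A.1 + (1 + oB / oA) * (x.1 - A.1).
  have -> : B'.1 = x.1 + oA * (B'.1 - x.1) / oA by field.
  by rewrite h1; field.
have f2 : B'.2 = A.2 + (1 + oB / oA) * (x.2 - A.2).
  have -> : B'.2 = x.2 + oA * (B'.2 - x.2) / oA by field.
  by rewrite h2; field.
by rewrite /on_edge -f1 -f2; case: (B').
Qed.

End EuclideanPlane.

(** * Convex polygons as periodic sequences of vertices *)

Section ConvexSequences.
Local Open Scope ring_scope.
Variable R : realType.
Implicit Types (C : seq (R * R)) (p : nat -> R * R) (s : nat -> R).

(** The polygon is unrolled to a sequence over all indices, so that paths may start anywhere and go
    round several times without modular indices. The window [k < i + n] keeps the three vertices
    distinct. *)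
Definition convex_seq (n : nat) p : Prop :=
  [/\ (3 <= n)%N, forall i, p (i + n)%N = p i &
      forall i j k, (i < j)%N -> (j < k)%N -> (k < i + n)%N ->
        0 < orient (p i) (p j) (p k)].

Lemma neq_mod_close (n i k : nat) : (i < k)%N -> (k < i + n)%N -> (k %% n != i %% n)%N.
Proof.
move=> ik kin; rewrite eqn_mod_dvd ?(ltnW ik) //; apply/negP => /dvdn_leq.
by rewrite subn_gt0 ik => /(_ isT); lia.
Qed.

Lemma vertex_mod C i : vertex C (i %% size C) = vertex C i.
Proof. by rewrite /vertex modn_mod. Qed.

Lemma vertexS_mod C i : vertex C (i %% size C).+1 = vertex C i.+1.
Proof. by rewrite /vertex -addn1 modnDml addn1. Qed.

(** [convex_polygon] only speaks of triples that contain a side. General triples follow by induction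
    on [k], the triangles at the common vertex [i] being linked by a Plücker relation. *)
Lemma convex_polygon_seq C : convex_polygon C -> convex_seq (size C) (vertex C).
Proof.
move=> [n3 hC]; set n := size C in n3 *.
have n0 : (0 < n)%N by lia.
have edge i k : (k %% n != i %% n)%N -> (k %% n != i.+1 %% n)%N ->
    0 < orient (vertex C i) (vertex C i.+1) (vertex C k).
  move=> h1 h2; have := hC (i %% n)%N (k %% n)%N.
  rewrite !vertex_mod vertexS_mod; apply; rewrite ?ltn_pmod //.
  by rewrite -addn1 modnDml addn1.
split=> // [i|]; first by rewrite /vertex modnDr.
move=> i j k ij; elim: k => // k IH jk kn.
case: (ltngtP i.+1 j) => [ij1|?|<-]; last 1 first.
- by apply: edge; apply: neq_mod_close; lia.
- case: (ltngtP j k) => [jk1|?|<-]; [|lia|].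
    have u1 : 0 < orient (vertex C i) (vertex C i.+1) (vertex C k).
      by apply: edge; apply: neq_mod_close; lia.
    have u2 : 0 < orient (vertex C i) (vertex C i.+1) (vertex C k.+1).
      by apply: edge; apply: neq_mod_close; lia.
    have u3 : 0 < orient (vertex C i) (vertex C i.+1) (vertex C j).
      by apply: edge; apply: neq_mod_close; lia.
    have u4 : 0 < orient (vertex C i) (vertex C k) (vertex C k.+1).
      by rewrite orient_rot; apply: edge; rewrite eq_sym; apply: neq_mod_close; lia.
    have u5 := IH jk1 (ltnW kn).
    rewrite -(pmulr_rgt0 _ u1).
    (* Three-term Plücker relation; every orientation in it other than the one sought is already
       known to be positive. *)
    have -> : orient (vertex C i) (vertex C i.+1) (vertex C k) *
        orient (vertex C i) (vertex C j) (vertex C k.+1) =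
        orient (vertex C i) (vertex C i.+1) (vertex C j) *
        orient (vertex C i) (vertex C k) (vertex C k.+1) +
        orient (vertex C i) (vertex C i.+1) (vertex C k.+1) *
        orient (vertex C i) (vertex C j) (vertex C k).
      by rewrite /orient; ring.
    by rewrite addr_gt0 ?mulr_gt0.
  by rewrite orient_rot; apply: edge; rewrite eq_sym; apply: neq_mod_close; lia.
- lia.
Qed.

Lemma seq_convex_polygon C : (3 <= size C)%N ->
  (forall i j k, (i < j)%N -> (j < k)%N -> (k < size C)%N ->
     0 < orient (nth (0, 0) C i) (nth (0, 0) C j) (nth (0, 0) C k)) ->
  convex_polygon C.
Proof.
move=> n3 h; split=> // i k iC kC ki; rewrite /vertex (modn_small iC) (modn_small kC).
case: (ltngtP i.+1 (size C)) => [h1|h1|h1].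
- rewrite modn_small // => ki1.
  case: (ltngtP k i) => [h2|h2|h2].
  + by rewrite -orient_rot; apply: h; lia.
  + by apply: h; move: ki1; lia.
  + by rewrite h2 eqxx in ki.
- lia.
- rewrite h1 modnn => k0.
  by rewrite orient_rot; apply: h; lia.
Qed.

Lemma mix_ge0 (t x y : R) : 0 <= t <= 1 -> 0 <= x -> 0 <= y -> 0 <= (1 - t) * x + t * y.
Proof. by move=> /andP[t0 t1] x0 y0; rewrite addr_ge0 ?mulr_ge0 ?subr_ge0. Qed.

Lemma mix_gt0 (t x y : R) : 0 <= t < 1 -> 0 < x -> 0 <= y -> 0 < (1 - t) * x + t * y.
Proof. by move=> /andP[t0 t1] x0 y0; rewrite ltr_pwDl ?mulr_gt0 ?mulr_ge0 ?subr_gt0. Qed.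

Variables (n : nat) (p : nat -> R * R).
Hypothesis cp : convex_seq n p.

Let n3 : (3 <= n)%N. Proof. by case: cp. Qed.
Let per i : p (i + n) = p i. Proof. by case: cp. Qed.
Let pos3 i j k : (i < j)%N -> (j < k)%N -> (k < i + n)%N ->
  0 < orient (p i) (p j) (p k).
Proof. by case: cp => _ _; apply. Qed.

Lemma convex_seq_ge0 i j k : (i <= j)%N -> (j <= k)%N -> (k <= i + n)%N ->
  0 <= orient (p i) (p j) (p k).
Proof.
rewrite leq_eqVlt => /predU1P[<-|ij]; first by rewrite orient_xx.
rewrite leq_eqVlt => /predU1P[<-|jk]; first by rewrite orient_xyy.
rewrite leq_eqVlt => /predU1P[->|ki]; first by rewrite per orient_xyx.
exact/ltW/pos3.
Qed.

(** [orient] is affine in each argument, so the value is a weighted mean of its values at the eight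
    choices of end points. *)
Lemma orient_sides_ge0 i j k (s t u : R) : (i < j)%N -> (j < k)%N -> (k < i + n)%N ->
  0 <= s <= 1 -> 0 <= t <= 1 -> 0 <= u <= 1 ->
  0 <= orient (on_edge (p i) (p i.+1) s) (on_edge (p j) (p j.+1) t)
              (on_edge (p k) (p k.+1) u).
Proof.
move=> ij jk ki hs ht hu.
have H a b c : (i <= a <= i.+1)%N -> (j <= b <= j.+1)%N -> (k <= c <= k.+1)%N ->
    0 <= orient (p a) (p b) (p c).
  by move=> *; apply: convex_seq_ge0; lia.
by rewrite orient_edge; apply: mix_ge0 => //;
   rewrite -orient_rot orient_edge; apply: mix_ge0 => //;
   rewrite -orient_rot orient_edge; apply: mix_ge0 => //;
   rewrite -orient_rot; apply: H; lia.
Qed.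

(** Half-open parameters give positive weight to the triple of starting vertices, which is strictly
    positively oriented; the other seven triples contribute nonnegative terms. *)
Lemma orient_sides_gt0 i j k (s t u : R) : (i < j)%N -> (j < k)%N -> (k < i + n)%N ->
  0 <= s < 1 -> 0 <= t < 1 -> 0 <= u < 1 ->
  0 < orient (on_edge (p i) (p i.+1) s) (on_edge (p j) (p j.+1) t)
              (on_edge (p k) (p k.+1) u).
Proof.
move=> ij jk ki hs ht hu.
have H a b c : (i <= a <= i.+1)%N -> (j <= b <= j.+1)%N -> (k <= c <= k.+1)%N ->
    0 <= orient (p a) (p b) (p c).
  by move=> *; apply: convex_seq_ge0; lia.
have W (x : R) : 0 <= x < 1 -> 0 <= x <= 1 by move=> /andP[-> /ltW].
rewrite orient_edge; apply: mix_gt0 => //; rewrite -orient_rot orient_edge;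
  [apply: mix_gt0 => // | apply: mix_ge0; first exact: W];
  rewrite -orient_rot orient_edge;
  [apply: mix_gt0 => // | apply: mix_ge0; first exact: W ..];
  rewrite -orient_rot; [exact: pos3 | apply: H; lia ..].
Qed.

Lemma convex_seq_neq i : p i != p i.+1.
Proof.
apply/eqP => e; have := @pos3 i i.+1 i.+2 (ltnSn _) (ltnSn _).
by rewrite e orient_xx ltxx => /(_ ltac:(lia)).
Qed.

Lemma orient_next_side i (s : R) : 0 < s ->
  0 < orient (p i) (p i.+1) (on_edge (p i.+1) (p i.+2) s).
Proof.
by move=> s0; rewrite orient_edge orient_xyy mulr0 add0r mulr_gt0 //; apply: pos3; lia.
Qed.

Lemma orient_prev_side i (s : R) : s < 1 ->
  0 < orient (p i.+1) (p i.+2) (on_edge (p i) (p i.+1) s).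
Proof.
move=> s1; rewrite orient_edge orient_xyx mulr0 addr0.
apply: mulr_gt0; first by rewrite subr_gt0.
by rewrite -orient_rot; apply: pos3; lia.
Qed.

End ConvexSequences.

(** * Paths between two vertices *)

Section Paths.
Local Open Scope ring_scope.
Variable R : realType.
Implicit Types (p g : nat -> R * R) (s : nat -> R) (a b i : nat).

Definition chain g (l h : nat) : R := \sum_(l <= t < h) dist (g t) (g t.+1).

Lemma chain_cat g (l m h : nat) : (l <= m)%N -> (m <= h)%N ->
  chain g l h = chain g l m + chain g m h.
Proof. by move=> lm mh; rewrite /chain (big_cat_nat lm mh). Qed.

Lemma chain1 g l : chain g l l.+1 = dist (g l) (g l.+1).
Proof. exact: big_nat1. Qed.

Lemma chain_nil g l : chain g l l = 0.
Proof. exact: big_geq. Qed.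

Lemma chain_ge0 g l h : 0 <= chain g l h.
Proof. by apply: sumr_ge0 => i _; exact: dist_ge0. Qed.

Lemma eq_chain g g' l h : (forall i, (l <= i <= h)%N -> g i = g' i) ->
  chain g l h = chain g' l h.
Proof.
by move=> e; apply: eq_big_nat => i ?; rewrite !e //; lia.
Qed.

Lemma dist_le_chain g l h : (l <= h)%N -> dist (g l) (g h) <= chain g l h.
Proof.
elim: h => [|h IH]; first by rewrite leqn0 => /eqP ->; rewrite distxx chain_nil.
rewrite leq_eqVlt => /predU1P[->|lh]; first by rewrite distxx chain_nil.
rewrite (@chain_cat _ _ h) // chain1.
by apply: le_trans (dist_triangle (g h) _ _) _; rewrite lerD2r IH.
Qed.

Lemma chain_at g l i h : (l < i)%N -> (i < h)%N ->
  chain g l h = chain g l i.-1 + (dist (g i.-1) (g i) + dist (g i) (g i.+1))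
    + chain g i.+1 h.
Proof.
move=> li ih; rewrite (@chain_cat _ _ i) ?(ltnW li) ?(ltnW ih) //.
rewrite (@chain_cat _ i i.+1) // chain1 (@chain_cat _ l i.-1) ?leq_pred //; last by lia.
by rewrite -{3}(ltn_predK li) chain1 (ltn_predK li) -!addrA.
Qed.

Definition pos p s i := on_edge (p i) (p i.+1) (s i).

Definition unit_seq s := forall i, 0 <= s i <= 1.

Definition upd s i (v : R) := fun j => if j == i then v else s j.

Lemma unit_upd s i v : unit_seq s -> 0 <= v <= 1 -> unit_seq (upd s i v).
Proof. by move=> h hv j; rewrite /upd; case: ifP. Qed.

Lemma pos_upd p s i v : pos p (upd s i v) i = on_edge (p i) (p i.+1) v.
Proof. by rewrite /pos /upd eqxx. Qed.

Lemma pos_upd_neq p s i v j : j != i -> pos p (upd s i v) j = pos p s j.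
Proof. by rewrite /pos /upd => /negPf ->. Qed.

(* Length of the path from [p a] to [p b] through the points with parameters
   [s] on the sides [a], ..., [b - 1]. *)
Definition path_len p a b s : R :=
  dist (p a) (pos p s a) + chain (pos p s) a b.-1 + dist (pos p s b.-1) (p b).

Lemma eq_path_len p a b s s' : (a < b)%N -> (forall i, (a <= i < b)%N -> s i = s' i) ->
  path_len p a b s = path_len p a b s'.
Proof.
move=> ab e; rewrite /path_len.
have ep i : (a <= i <= b.-1)%N -> pos p s i = pos p s' i.
  by move=> hi; rewrite /pos e //; lia.
by rewrite (eq_chain ep) !ep //; lia.
Qed.

Lemma dist_le_path p a b s : (a < b)%N -> dist (p a) (p b) <= path_len p a b s.
Proof.
move=> ab; apply: le_trans (dist_triangle (pos p s b.-1) _ _) _.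
rewrite lerD2r; apply: le_trans (dist_triangle (pos p s a) _ _) _.
by rewrite lerD2l dist_le_chain //; lia.
Qed.

(** The concatenated path does not stop at [p i], whence an inequality; when the path does pass
    through [p i], [path_len_split] gives equality. *)
Lemma path_len_cat p a i b s s1 s2 : (a < i)%N -> (i < b)%N ->
  (forall j, (j < i)%N -> s j = s1 j) -> (forall j, (i <= j)%N -> s j = s2 j) ->
  path_len p a b s <= path_len p a i s1 + path_len p i b s2.
Proof.
move=> ai ib e1 e2.
rewrite -(@eq_path_len _ a i s) //; last by move=> j ?; apply: e1; lia.
rewrite -(@eq_path_len _ i b s) //; last by move=> j ?; apply: e2; lia.
rewrite /path_len (@chain_cat _ a i.-1 b.-1); [|lia ..].
rewrite (@chain_cat _ i.-1 i b.-1); [|lia ..].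
have -> : chain (pos p s) i.-1 i = dist (pos p s i.-1) (pos p s i).
  by rewrite -{2}(ltn_predK ai) chain1 (ltn_predK ai).
have := dist_triangle (p i) (pos p s i.-1) (pos p s i); lra.
Qed.

Lemma path_len_split p a i b s : (a < i)%N -> (i < b)%N ->
  pos p s i.-1 = p i \/ pos p s i = p i ->
  path_len p a b s = path_len p a i s + path_len p i b s.
Proof.
move=> ai ib e.
rewrite /path_len (@chain_cat _ a i.-1 b.-1); [|lia ..].
rewrite (@chain_cat _ i.-1 i b.-1); [|lia ..].
have -> : chain (pos p s) i.-1 i = dist (pos p s i.-1) (p i) + dist (p i) (pos p s i).
  rewrite -{2}(ltn_predK ai) chain1 (ltn_predK ai).
  by case: e => ->; rewrite distxx ?add0r ?addr0.
by lra.
Qed.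

Definition path_min p a b s := unit_seq s /\
  forall s', unit_seq s' -> path_len p a b s <= path_len p a b s'.

(** Optimal substructure: a better path on either part could be spliced with the other part, and by
    [path_len_cat] the result would beat [s]. *)
Lemma path_min_split p a i b s : (a < i)%N -> (i < b)%N ->
  pos p s i.-1 = p i \/ pos p s i = p i ->
  path_min p a b s -> path_min p a i s /\ path_min p i b s.
Proof.
move=> ai ib e [us hs].
have cut s1 s2 : unit_seq s1 -> unit_seq s2 ->
    path_len p a b s <= path_len p a i s1 + path_len p i b s2.
  move=> us1 us2; pose s3 j := if (j < i)%N then s1 j else s2 j.
  have us3 : unit_seq s3 by move=> j; rewrite /s3; case: ifP.
  apply: le_trans (hs _ us3) _; apply: path_len_cat => // j hj; rewrite /s3.
    by rewrite hj.
  by rewrite ltnNge hj.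
have eL := path_len_split ai ib e.
by split; split=> // s' us'; [have := cut s' s us' us | have := cut s s' us us'];
  rewrite eL ?lerD2r ?lerD2l.
Qed.

(** The path starts at [p a], which lies on side [a], so its first stop may be moved there. With
    [path_len_end] this gives the normal form [s a = 0], [s b.-1 = 1] used by [piece_opt]; the two
    changes concern different sides because [a.+1 < b]. *)
Lemma path_len_start p a b s : (a.+1 < b)%N ->
  path_len p a b (upd s a 0) <= path_len p a b s.
Proof.
move=> ab; rewrite /path_len pos_upd on_edge0 distxx add0r.
rewrite pos_upd_neq; last by lia.
rewrite lerD2r !(@chain_cat _ a a.+1 b.-1); [|lia ..].
rewrite !chain1 pos_upd on_edge0 pos_upd_neq; last by lia.
rewrite addrA; apply: lerD; first exact: dist_triangle.
by rewrite (@eq_chain _ (pos p s)) // => i ?; rewrite pos_upd_neq //; lia.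
Qed.

Lemma path_len_end p a b s : (a.+1 < b)%N ->
  path_len p a b (upd s b.-1 1) <= path_len p a b s.
Proof.
move=> ab; rewrite /path_len pos_upd (ltn_predK ab) on_edge1 distxx addr0.
rewrite pos_upd_neq; last by lia.
have chE g : chain g a b.-1 = chain g a b.-2 + dist (g b.-2) (g b.-1).
  rewrite (@chain_cat _ a b.-2 b.-1); [|lia ..].
  have -> : b.-1 = b.-2.+1 by lia.
  by rewrite chain1.
rewrite -!addrA lerD2l !chE pos_upd (ltn_predK ab) on_edge1 pos_upd_neq; last by lia.
rewrite -addrA; apply: lerD; last exact: dist_triangle.
by rewrite (@eq_chain _ (pos p s)) // => i ?; rewrite pos_upd_neq //; lia.
Qed.

(* Programs have no absolute value, hence the square roots. *)
Definition clamp (x : R) : R := (1 + Num.sqrt (x * x) - Num.sqrt ((x - 1) * (x - 1))) / 2.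

Lemma clampE x : clamp x = if x <= 0 then 0 else if x <= 1 then x else 1.
Proof.
rewrite /clamp -!expr2 !sqrtr_sqr; case: ifPn => [h|].
  have h1 : x - 1 <= 0 by lra.
  by rewrite (ler0_norm h) (ler0_norm h1); field.
rewrite -ltNge => h; rewrite (gtr0_norm h); case: ifPn => [h1|].
  have h2 : x - 1 <= 0 by lra.
  by rewrite (ler0_norm h2); field.
rewrite -ltNge => h1.
have h2 : 0 < x - 1 by lra.
by rewrite (gtr0_norm h2); field.
Qed.

Lemma clamp_unit x : 0 <= clamp x <= 1.
Proof.
by rewrite clampE; case: (lerP x 0) => h; [|case: (lerP x 1) => h1];
  rewrite ?lexx ?ler01 // (ltW h).
Qed.

Lemma clamp_id x : 0 <= x <= 1 -> clamp x = x.
Proof.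
rewrite clampE => /andP[x0 ->]; case: ifP => // h.
by apply/eqP; rewrite eq_le x0 h.
Qed.

(* Parameter on [pq] of the crossing of [pq] with the line [ct]; it is 0 when
   [c = p]. *)
Definition crossing (p q c t : R * R) : R :=
  ((t.1 - c.1) * (c.2 - p.2) - (t.2 - c.2) * (c.1 - p.1)) /
  ((t.1 - c.1) * (q.2 - p.2) - (t.2 - c.2) * (q.1 - p.1)).

Lemma crossing_start (p q t : R * R) : crossing p q p t = 0.
Proof. by rewrite /crossing !subrr !mulr0 subrr mul0r. Qed.

Lemma crossing_edge (p q c : R * R) (s k : R) : 0 < orient p q c -> 0 < k ->
  crossing p q c (on_edge c (on_edge p q s) k) = s.
Proof.
move=> o k0; have kn := lt0r_neq0 k0; have on := lt0r_neq0 o.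
rewrite /crossing /on_edge /=.
set d := (X in _ / X).
have dE : d = k * orient p q c by rewrite /d /orient; ring.
have d0 : d != 0 by rewrite dE mulf_neq0.
by apply: (mulIf d0); rewrite divfK // /d; ring.
Qed.

(* The straight path from [p a] to [p b] in the polygons unfolded along the
   sides [a], ..., [b - 1]: [unfold p b k] is the image of [p b] reflected in
   the sides [b - 2], ..., [b - 1 - k], and the path crosses side [i] on its way
   towards [unfold p b (b - 1 - i)]. Clamping keeps every path feasible, so
   that a path whose straight version leaves the polygons is merely longer. *)
Fixpoint unfold p b k : R * R :=
  if k is k'.+1 then mirror (p (b.-1 - k)%N) (p (b.-1 - k).+1) (unfold p b k') else p b.

Fixpoint piece_point p a b k : R * R :=
  if k is k'.+1 then
    on_edge (p (a + k')%N) (p (a + k').+1)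
      (clamp (crossing (p (a + k')%N) (p (a + k').+1) (piece_point p a b k')
                (unfold p b (b.-1 - (a + k'))%N)))
  else p a.

Definition piece p a b i : R :=
  clamp (crossing (p i) (p i.+1) (piece_point p a b (i - a)%N) (unfold p b (b.-1 - i)%N)).

Lemma unit_piece p a b : unit_seq (piece p a b).
Proof. by move=> i; apply: clamp_unit. Qed.

Lemma piece_pointS p a b i : (a <= i)%N -> piece_point p a b (i - a).+1 = pos p (piece p a b) i.
Proof. by move=> ai /=; rewrite subnKC. Qed.

Definition piece_len p a b : R := path_len p a b (piece p a b).

Section Optimal.
Variables (n : nat) (p : nat -> R * R).
Hypothesis cp : convex_seq n p.

(** With a single side the normal form [s a = 0], [s b.-1 = 1] is contradictory, so this case is
    treated apart. *)
Lemma piece_len_edge a : piece_len p a a.+1 = dist (p a) (p a.+1).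
Proof.
rewrite /piece_len /path_len /= chain_nil addr0 /pos /piece subnn /= crossing_start.
by rewrite clamp_id ?lexx ?ler01 // on_edge0 distxx add0r.
Qed.

(** Varying [s i] alone affects only the two edges at that point, so [reflection_law] applies. The
    conditions on [s i.-1] and [s i.+1] put the neighbours strictly to the left of side [i]. *)
Lemma reflection_in_chain l i h s : (l < i)%N -> (i < h)%N ->
  unit_seq s -> 0 < s i < 1 -> s i.-1 < 1 -> 0 < s i.+1 ->
  (forall v, 0 <= v <= 1 -> chain (pos p s) l h <= chain (pos p (upd s i v)) l h) ->
  exists2 r, 0 < r &
  mirror (p i) (p i.+1) (pos p s i.+1) = on_edge (pos p s i.-1) (pos p s i) (1 + r).
Proof.
move=> li ih us si sp sn hs.
have i0 : (0 < i)%N by lia.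
have oA : 0 < orient (p i) (p i.+1) (pos p s i.-1).
  by have := orient_prev_side cp i.-1 sp; rewrite /pos !prednK.
have oB : 0 < orient (p i) (p i.+1) (pos p s i.+1).
  exact: (orient_next_side cp i sn).
exists (orient (p i) (p i.+1) (pos p s i.+1) / orient (p i) (p i.+1) (pos p s i.-1)).
  exact: divr_gt0.
apply: reflection_law => //; first exact: (convex_seq_neq cp).
move=> v hv; have := hs v hv; rewrite !(chain_at _ li ih).
rewrite pos_upd !pos_upd_neq; [|lia ..].
rewrite (@eq_chain (pos p (upd s i v)) (pos p s) l i.-1); last first.
  by move=> j ?; rewrite pos_upd_neq //; lia.
rewrite (@eq_chain (pos p (upd s i v)) (pos p s) i.+1 h); last first.
  by move=> j ?; rewrite pos_upd_neq //; lia.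
by rewrite lerD2r lerD2l.
Qed.

(** Between visits to vertices the reflection law leaves no freedom: a shortest path in normal form
    is recovered, parameter by parameter, by the unfolding. *)
Lemma piece_opt a b s : (a.+1 < b)%N -> path_min p a b s ->
  (forall i, (a < i < b)%N -> s i.-1 < 1 /\ 0 < s i) ->
  s a = 0 -> s b.-1 = 1 ->
  forall i, (a <= i < b)%N -> piece p a b i = s i.
Proof.
move=> ab [us hs] inner sa sb.
have xb : pos p s b.-1 = p b by rewrite /pos sb (ltn_predK ab) on_edge1.
have refl i : (a < i < b.-1)%N -> exists2 r, 0 < r &
    mirror (p i) (p i.+1) (pos p s i.+1) = on_edge (pos p s i.-1) (pos p s i) (1 + r).
  move=> hi.
  have [s1 s0] : s i.-1 < 1 /\ 0 < s i by apply: inner; lia.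
  have [s1' s0'] : s i < 1 /\ 0 < s i.+1 by apply: (inner i.+1); lia.
  apply: (@reflection_in_chain a i b.-1) => //; rewrite ?s0 ?s1' //; [lia..|].
  move=> v hv; have := hs _ (unit_upd i us hv).
  rewrite /path_len !pos_upd_neq; [|lia ..].
  by rewrite lerD2r lerD2l.
(* Backward induction: in the unfolding along the remaining sides, the image of [p b] lies on the
   ray along the path edge that arrives at side [b.-1 - k]. *)
have unf k : (k < b.-1 - a)%N -> exists2 m, 0 < m &
    unfold p b k = on_edge (pos p s (b.-1 - k).-1) (pos p s (b.-1 - k)) m.
  elim: k => [|k IH] hk.
    by exists 1; rewrite ?ltr01 // subn0 on_edge1.
  have [m m0 mE] := IH (ltnW hk).
  have [|r r0 rE] := refl (b.-1 - k.+1)%N; first by lia.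
  exists (1 + m * r); first by rewrite addr_gt0 ?mulr_gt0.
  rewrite [LHS]/= mE.
  have e1 : (b.-1 - k).-1 = (b.-1 - k.+1)%N by lia.
  have e2 : (b.-1 - k)%N = (b.-1 - k.+1).+1 by lia.
  rewrite e1 {1}e2 mirror_edge ?(convex_seq_neq cp) // -[on_edge (p _) _ _]/(pos p s _) rE.
  by rewrite /on_edge /=; congr (_, _); ring.
(* Forward induction: from a correctly placed point, the line towards the image of [p b] crosses the
   next side at the next point of the path, and clamping changes nothing. *)
have main k : (a + k < b)%N -> piece p a b (a + k) = s (a + k)%N.
  elim: k => [|k IH] hk.
    by rewrite addn0 /piece subnn /= crossing_start clamp_id ?lexx ?ler01 ?sa.
  rewrite /piece.
  have -> : piece_point p a b (a + k.+1 - a) = pos p s (a + k).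
    have -> : (a + k.+1 - a = (a + k - a).+1)%N by lia.
    by rewrite piece_pointS ?leq_addr // /pos IH //; lia.
  have [|m m0 ->] := unf (b.-1 - (a + k.+1))%N; first by lia.
  have -> : (b.-1 - (b.-1 - (a + k.+1)) = (a + k).+1)%N by lia.
  rewrite addnS /= [pos p s (a + k).+1]/pos crossing_edge //.
    exact: clamp_id.
  apply: (orient_prev_side cp).
  by have [] := inner (a + k).+1 ltac:(lia).
by move=> i hi; have := main (i - a)%N; rewrite subnKC; [apply|]; lia.
Qed.

(** [W] is any potential that no single piece improves, such as the values of the dynamic program.
    By induction on [b - a], a shortest path that meets an intermediate vertex is cut there;
    otherwise it is, in normal form, a piece. *)
Lemma shortest_path (W : nat -> R) a0 b0 :
  (forall a b, (a0 <= a)%N -> (a < b)%N -> (b <= b0)%N -> W b <= W a + piece_len p a b) ->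
  forall a b s, (a0 <= a)%N -> (a < b)%N -> (b <= b0)%N -> path_min p a b s ->
  W b <= W a + path_len p a b s.
Proof.
move=> hW a b s; move: {2}(b - a)%N (leqnn (b - a)) => m.
elim: m a b => [|m IH] a b; first by lia.
move=> bam a0a ab bb0 ms.
case: (boolP [exists i : 'I_b, (a < i)%N && ((1 <= s i.-1) || (s i <= 0))]).
  move=> /existsP[i /andP[ai hi]]; have ib := ltn_ord i.
  have ei : pos p s i.-1 = p i \/ pos p s i = p i.
    case/orP: hi => hi; [left|right].
      have /andP[_ h] := ms.1 i.-1.
      have e1 : s i.-1 = 1 by apply/eqP; rewrite eq_le h.
      by rewrite /pos e1 on_edge1 (ltn_predK ai).
    have /andP[h _] := ms.1 i.
    have e0 : s i = 0 by apply/eqP; rewrite eq_le hi.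
    by rewrite /pos e0 on_edge0.
  have [m1 m2] := path_min_split ai ib ei ms.
  rewrite (path_len_split ai ib ei).
  have h1 : W i <= W a + path_len p a i s by apply: IH => //; lia.
  have h2 : W b <= W i + path_len p i b s by apply: IH => //; lia.
  by lra.
move=> /existsPn none.
have inner i : (a < i < b)%N -> s i.-1 < 1 /\ 0 < s i.
  move=> /andP[ai ib]; have := none (Ordinal ib) => /=.
  by rewrite ai negb_or -!ltNge => /andP[].
have := ab; rewrite leq_eqVlt => /predU1P[e|ab1].
  rewrite -e; apply: le_trans (hW a a.+1 _ _ _) _ => //; first by rewrite e.
  by rewrite lerD2l piece_len_edge dist_le_path.
pose s1 := upd s a 0; pose s2 := upd s1 b.-1 1.
have us1 : unit_seq s1 by apply: unit_upd => //; [exact: ms.1|rewrite lexx ler01].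
have us2 : unit_seq s2 by apply: unit_upd => //; rewrite lexx ler01.
have le2 : path_len p a b s2 <= path_len p a b s.
  exact: le_trans (path_len_end _ _ ab1) (path_len_start _ _ ab1).
have ms2 : path_min p a b s2.
  by split=> // s' us'; apply: le_trans le2 (ms.2 _ us').
apply: le_trans (hW a b a0a ab bb0) _; rewrite lerD2l.
apply: le_trans le2; rewrite /piece_len (@eq_path_len _ _ _ _ s2) //.
apply: piece_opt => //.
- move=> i hi; have [h1 h2] := inner i hi; rewrite /s2 /s1 /upd.
  by split; [case: eqP; [lia|]; case: eqP => //| case: eqP => // _; case: eqP => //; lia].
- by rewrite /s2 /s1 /upd; case: eqP; [lia|]; rewrite eqxx.
- by rewrite /s2 /upd eqxx.
Qed.

End Optimal.
End Paths.

(** * Closed paths *)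

Section Minimum.
Local Open Scope ring_scope.
Local Open Scope classical_set_scope.
Variable R : realType.
Implicit Types (p : nat -> R * R) (s : nat -> R).

Lemma continuous_hyp (T : topologicalType) (f g : T -> R) :
  continuous f -> continuous g -> continuous (fun x => hyp (f x) (g x)).
Proof.
move=> cf cg x; apply: continuous_comp; last exact: sqrt_continuous.
by apply: cvgD; rewrite !expr2; apply: cvgM; (exact: cf || exact: cg).
Qed.

Lemma continuous_affine (T : topologicalType) (f : T -> R) (a b : R) :
  continuous f -> continuous (fun x => a + f x * b).
Proof.
move=> cf x; apply: cvgD; first exact: cvg_cst.
by apply: cvgM; [exact: cf | exact: cvg_cst].
Qed.

Lemma continuous_add (T : topologicalType) (f g : T -> R) :
  continuous f -> continuous g -> continuous (fun x => f x + g x).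
Proof. by move=> cf cg x; apply: cvgD; [exact: cf | exact: cg]. Qed.

Lemma continuous_sub (T : topologicalType) (f g : T -> R) :
  continuous f -> continuous g -> continuous (fun x => f x - g x).
Proof. by move=> cf cg x; apply: cvgB; [exact: cf | exact: cg]. Qed.

(** Closed paths are parametrized by row vectors, for which compactness of boxes is available, and
    then extended periodically. *)
Definition extend N (v : 'rV[R]_N.+1) : nat -> R := fun t => v ord0 (inord (t %% N.+1)).

Lemma continuous_chain_extend p N (l h : nat) :
  continuous (fun v : 'rV[R]_N.+1 => chain (pos p (extend v)) l h).
Proof.
have cext t : continuous (fun v : 'rV[R]_N.+1 => extend v t).
  exact: coord_continuous.
rewrite /chain; elim: (index_iota l h) => [|t r IH].
  by under eq_fun do rewrite big_nil; exact: cst_continuous.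
under eq_fun do rewrite big_cons.
apply: (@continuous_add _ (fun v : 'rV[R]_N.+1 =>
  dist (pos p (extend v) t) (pos p (extend v) t.+1))) => //.
rewrite /dist /pos /on_edge /=.
by apply: (@continuous_hyp 'rV[R]_N.+1); apply: (@continuous_sub 'rV[R]_N.+1);
  apply: (@continuous_affine 'rV[R]_N.+1).
Qed.

(** The extreme value theorem is applied twice: to the length on the unit cube, then to the
    parameter on side 0 on the compact set [B] of shortest paths. This tie-break is what
    [interior_not_lex_min] contradicts. *)
Lemma exists_lex_min p N : exists s, [/\ unit_seq s, forall t, s (t + N.+1)%N = s t &
  forall s', unit_seq s' -> (forall t, s' (t + N.+1)%N = s' t) ->
    chain (pos p s) 0 N.+1 <= chain (pos p s') 0 N.+1 /\
    (chain (pos p s') 0 N.+1 <= chain (pos p s) 0 N.+1 -> s 0%N <= s' 0%N)].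
Proof.
pose A := [set v : 'rV[R]_N.+1 | forall i, `[(0 : R), 1]%classic (v ord0 i)].
have cA : compact A.
  by apply: (@rV_compact _ _ (fun=> `[(0 : R), 1]%classic)) => _; apply: segment_compact.
pose F (v : 'rV[R]_N.+1) := chain (pos p (extend v)) 0 N.+1.
have cF : continuous F by exact: continuous_chain_extend.
have A0 : A !=set0.
  by exists 0 => i; rewrite /= mxE in_itv /= lexx ler01.
have [v vA vmin] := EVT_min_rV A0 cA (continuous_subspaceT cF).
pose B := A `&` (F @^-1` [set x | x <= F v]).
have cB : compact B.
  apply: (subclosed_compact _ cA); last by move=> w [].
  apply: closedI; first exact: compact_closed.
  by apply: closed_comp; [move=> w _; exact: cF | exact: closed_le].
have B0 : B !=set0 by exists v; split=> /=; [exact: set_mem | exact: lexx].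
have cC : continuous (fun w : 'rV[R]_N.+1 => w ord0 ord0) by exact: coord_continuous.
have [w /set_mem [wA wF] wmin] := EVT_min_rV B0 cB (continuous_subspaceT cC).
have unitA u : A u -> unit_seq (extend u).
  by move=> uA t; have := uA (inord (t %% N.+1)); rewrite /= in_itv.
exists (extend w); split; first exact: unitA.
  by move=> t; rewrite /extend modnDr.
move=> s' us' per.
pose u : 'rV[R]_N.+1 := \row_i s' i.
have uE t : extend u t = s' t.
  rewrite /extend mxE inordK ?ltn_pmod // [in RHS](divn_eq t N.+1).
  elim: (t %/ N.+1)%N => [|k IH]; first by rewrite mul0n.
  by rewrite mulSn -addnA addnC per.
have uA : A u by move=> i; rewrite /= in_itv /= mxE; exact: us'.
have FuE : F u = chain (pos p s') 0 N.+1.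
  by rewrite /F; apply: eq_chain => i _; rewrite /pos uE.
rewrite -FuE -/(F w); split.
  by apply: le_trans wF _; apply: vmin; exact: mem_set.
move=> uw; have := wmin u; rewrite -(uE 0%N) /extend mod0n.
have -> : inord 0 = ord0 :> 'I_N.+1 by apply/val_inj; rewrite /= inordK.
apply; apply: mem_set; split=> //=; exact: le_trans uw wF.
Qed.

End Minimum.

(** * A shortest path of two rounds meets a vertex *)

Section ClosedPaths.
Local Open Scope ring_scope.
Variable R : realType.
Implicit Types (g : nat -> R * R) (s y z : nat -> R).

Definition periodic (T : Type) (N : nat) (g : nat -> T) := forall t, g (t + N)%N = g t.

Lemma chain_rot N g j : periodic N g -> chain g j (j + N) = chain g 0 N.
Proof.
move=> per; elim: j => [|j <-]; first by rewrite add0n.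
case: N per => [|N] per; first by rewrite !addn0 !chain_nil.
have e1 := @chain_cat _ g j j.+1 (j + N.+1) (leqnSn _).
have e2 := @chain_cat _ g j.+1 (j + N.+1) (j.+1 + N.+1).
rewrite e1 ?e2; [|lia ..].
rewrite chain1 addSn chain1 -addSn !per; ring.
Qed.

Lemma periodic_mul (T : Type) N (g : nat -> T) k t : periodic N g -> g (t + k * N)%N = g t.
Proof. by move=> per; elim: k => [|k IH]; rewrite ?addn0 // mulSn addnCA addnC per. Qed.

Lemma periodic_mod (T : Type) N (g : nat -> T) t : periodic N g -> g (t %% N)%N = g t.
Proof. by move=> per; rewrite [in RHS](divn_eq t N) addnC periodic_mul. Qed.

Variables (n : nat) (p : nat -> R * R).
Hypothesis cp : convex_seq n p.

Let n3 : (3 <= n)%N. Proof. by case: cp. Qed.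
Let per_p : periodic n p. Proof. by case: cp. Qed.
Let per_p2 : periodic (2 * n) p. Proof. by move=> t; rewrite periodic_mul. Qed.

Lemma periodic_pos N s : periodic N p -> periodic N s -> periodic N (pos p s).
Proof. by move=> pp ps t; rewrite /pos -addSn !pp ps. Qed.

(** Closing the path omits the stop at [p j], which cannot lengthen it. *)
Lemma close_up N j s y : (0 < N)%N -> periodic N p -> periodic N y ->
  (forall t, (j <= t < j + N)%N -> y t = s t) ->
  chain (pos p y) 0 N <= path_len p j (j + N) s.
Proof.
move=> N0 pp py e; rewrite -(@eq_path_len _ p _ _ y); [|lia|by []].
rewrite -(chain_rot j (periodic_pos pp py)) /path_len.
rewrite (@chain_cat _ _ j (j + N).-1 (j + N)); [|lia ..].
have -> : chain (pos p y) (j + N).-1 (j + N) =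
    dist (pos p y (j + N).-1) (pos p y (j + N)).
  by rewrite -{2}(@prednK (j + N)) ?chain1 ?prednK //; lia.
rewrite (periodic_pos pp py) pp.
have := dist_triangle (p j) (pos p y (j + N).-1) (pos p y j); lra.
Qed.

(** A closed path that already visits [p j] is cut open there at no cost. *)
Lemma closed_path_len N j s : (0 < N)%N -> periodic N p -> periodic N s ->
  pos p s j = p j \/ pos p s (j + N).-1 = p (j + N)%N ->
  path_len p j (j + N) s = chain (pos p s) 0 N.
Proof.
move=> N0 pp ps e; rewrite -(chain_rot j (periodic_pos pp ps)) /path_len.
rewrite (@chain_cat _ _ j (j + N).-1 (j + N)); [|lia ..].
have -> : chain (pos p s) (j + N).-1 (j + N) =
    dist (pos p s (j + N).-1) (pos p s (j + N)).
  by rewrite -{2}(@prednK (j + N)) ?chain1 ?prednK //; lia.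
rewrite (periodic_pos pp ps).
case: e => ->; first by rewrite distxx add0r pp.
by rewrite distxx addr0 pp addrC.
Qed.

Lemma small_for_all (P : nat -> R -> Prop) N :
  (forall i, exists2 d, 0 < d & forall t, `|t| <= d -> P i t) ->
  exists2 d, 0 < d & forall t, `|t| <= d -> forall i, (i < N)%N -> P i t.
Proof.
move=> h; elim: N => [|N [d d0 hd]]; first by exists 1.
have [d' d'0 hd'] := h N.
exists (Num.min d d'); first by rewrite lt_min d0.
move=> t; rewrite le_min => /andP[t1 t2] i.
by rewrite ltnS leq_eqVlt => /predU1P[->|]; [exact: hd' | exact: hd].
Qed.

Lemma small_mul (a b : R) : 0 < a -> exists2 d, 0 < d & forall t, `|t| <= d -> `|t * b| <= a.
Proof.
move=> a0; have b0 : 0 < `|b| + 1 by rewrite ltr_wpDl.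
exists (a / (`|b| + 1)); first exact: divr_gt0.
move=> t ht; rewrite normrM.
apply: le_trans (ler_wpM2r (normr_ge0 b) ht) _.
rewrite mulrAC ler_pdivrMr // ler_wpM2l ?(ltW a0) //; lra.
Qed.

(* If an optimal closed path avoided all vertices, its vertices could be moved
   alternately forward and backward so that every edge keeps its direction; the
   length is affine in this motion, hence constant. This needs the number of
   sides to be even, which is why one goes round the polygon twice. *)
Section Interior.
Variable s : nat -> R.
Let N := (2 * n)%N.
Hypothesis per_s : periodic N s.
Hypothesis inner : forall i, 0 < s i < 1.
Hypothesis min_s : forall s', unit_seq s' -> periodic N s' ->
  chain (pos p s) 0 N <= chain (pos p s') 0 N.

Let x := pos p s.
Let l i := dist (x i) (x i.+1).
Let o i := orient (p i) (p i.+1) (x i.+1).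

Let us : unit_seq s.
Proof. by move=> i; case/andP: (inner i) => h1 h2; rewrite !ltW. Qed.

Let o_gt0 i : 0 < o i.
Proof. by apply: (orient_next_side cp); case/andP: (inner i.+1). Qed.

Let l_gt0 i : 0 < l i.
Proof.
rewrite lt_neqAle dist_ge0 andbT eq_sym; apply/eqP => /hyp_eq0[].
move=> /eqP; rewrite subr_eq0 => /eqP e1 /eqP; rewrite subr_eq0 => /eqP e2.
have := o_gt0 i; rewrite /o.
have -> : x i.+1 = x i by rewrite [LHS]surjective_pairing e1 e2 -surjective_pairing.
by rewrite orient_edge_same ltxx.
Qed.

(** Equal angles at [x i.+1]: by similar triangles, the heights of its two neighbours over side
    [i.+1] are in the ratio of the two edge lengths. *)
Let balance i : o i.+1 * l i = orient (p i.+1) (p i.+2) (x i) * l i.+1.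
Proof.
have iN : (i.+1 < i + N)%N by rewrite /N; lia.
have [s1 s2] : s i < 1 /\ 0 < s i.+2.
  by case/andP: (inner i) => _ ->; case/andP: (inner i.+2) => ->.
have [v hv|r r0 rE] := reflection_in_chain cp (ltnSn i) iN us (inner i.+1) s1 s2.
  (* Minimality is known only against periodic paths, so the change at [i.+1] is repeated in every
     period; the window from [i] to [i + N] contains it once. *)
  pose y t := if (t %% N == i.+1 %% N)%N then v else s t.
  have py : periodic N y by move=> t; rewrite /y modnDr per_s.
  have uy : unit_seq y by move=> t; rewrite /y; case: ifP.
  have := min_s uy py.
  rewrite -(chain_rot i (periodic_pos per_p2 py)) -(chain_rot i (periodic_pos per_p2 per_s)).
  have ey t : (i <= t <= i + N)%N -> upd s i.+1 v t = y t.
    move=> ht; rewrite /upd /y.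
    have -> // : (t == i.+1) = (t %% N == i.+1 %% N)%N.
    apply/eqP/eqP => [->//|]; case: (ltngtP t i.+1) => // [h|h] /eqP.
      by rewrite eq_sym (negPf (neq_mod_close h _)) //; rewrite /N; lia.
    by rewrite (negPf (neq_mod_close h _)) //; rewrite /N; lia.
  by rewrite (@eq_chain _ (pos p (upd s i.+1 v)) (pos p y)) // => t ht; rewrite /pos ey.
have pq := convex_seq_neq cp i.+1.
have o1 : o i.+1 = r * orient (p i.+1) (p i.+2) (x i).
  rewrite /o -[LHS]opprK -orient_mirror // rE orient_edge orient_edge_same; ring.
have l1 : l i.+1 = r * l i.
  rewrite /l -(dist_mirror _ _ pq) -/(pos p s _) rE /= !distE -[X in X * hyp _ _]gtr0_norm //.
  by rewrite -hypZ /on_edge /=; congr hyp; ring.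
by rewrite o1 l1; ring.
Qed.

(** Velocity of the parameter [s i], chosen so that the normal speed of [x i] relative to the edge
    from [x i] to [x i.+1] is [(-1)^i]. By [balance] the other end of this edge has the same normal
    speed. *)
Let h i := (-1) ^+ i * l i / o i.

(** The relative velocity [(vx, vy)] of the two ends is parallel to the edge, which is therefore
    just rescaled, by [1 + t * m]. *)
Let shift i : exists m, forall t,
  dist (pos p (fun j => s j + t * h j) i) (pos p (fun j => s j + t * h j) i.+1) =
  `|1 + t * m| * l i.
Proof.
set dx := (x i.+1).1 - (x i).1; set dy := (x i.+1).2 - (x i).2.
pose vx := h i.+1 * ((p i.+2).1 - (p i.+1).1) - h i * ((p i.+1).1 - (p i).1).
pose vy := h i.+1 * ((p i.+2).2 - (p i.+1).2) - h i * ((p i.+1).2 - (p i).2).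
have l2 : l i ^+ 2 = dx ^+ 2 + dy ^+ 2 by exact: sqr_hyp.
have cr : vx * dy = vy * dx.
  apply/eqP; rewrite -subr_eq0; apply/eqP.
  transitivity (- (h i.+1 * orient (p i.+1) (p i.+2) (x i)) - h i * o i).
    rewrite /vx /vy /o /dx /dy /x /pos /on_edge /orient /=; ring.
  have -> : h i * o i = (-1) ^+ i * l i by rewrite /h divfK // lt0r_neq0.
  have -> : h i.+1 * orient (p i.+1) (p i.+2) (x i) = - ((-1) ^+ i * l i).
    have o0 := lt0r_neq0 (o_gt0 i.+1).
    apply: (mulIf o0); rewrite /h mulrAC divfK // -mulrA [l i.+1 * _]mulrC -balance exprS; ring.
  by rewrite opprK subrr.
have ln := lt0r_neq0 (l_gt0 i).
pose m := (vx * dx + vy * dy) / l i ^+ 2.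
have l20 : l i ^+ 2 != 0 by rewrite expf_neq0.
have vxE : vx = m * dx.
  apply: (mulIf l20); rewrite /m mulrAC divfK //.
  rewrite l2 mulrDr !expr2 mulrA [vx * (dy * dy)]mulrA cr; ring.
have vyE : vy = m * dy.
  apply: (mulIf l20); rewrite /m mulrAC divfK //.
  rewrite l2 mulrDr !expr2 mulrA -cr; ring.
exists m => t.
rewrite /l !distE -hypZ -/dx -/dy; congr hyp.
  transitivity (dx + t * vx); last by rewrite vxE; ring.
  by rewrite /dx /vx /x /pos /on_edge /=; ring.
transitivity (dy + t * vy); last by rewrite vyE; ring.
by rewrite /dy /vy /x /pos /on_edge /=; ring.
Qed.

Let per_h : periodic N h.
Proof.
move=> i; rewrite /h /l /o /x /N -addSn !(periodic_pos per_p2 per_s) !per_p2.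
by rewrite exprD exprM sqrrN expr1n expr1n mulr1.
Qed.

(** For small [t] all factors [1 + t * m i] are nonnegative, so the length is affine in [t] with
    slope [K]. Minimality at [d] and [- d] forces [K = 0], and the motion by [- d] lowers [s 0]
    because [h 0 > 0]. *)
Lemma interior_not_lex_min : exists s', [/\ unit_seq s', periodic N s',
  chain (pos p s') 0 N <= chain (pos p s) 0 N & s' 0%N < s 0%N].
Proof.
have [m hm] := boolp.choice shift.
pose st t j := s j + t * h j.
have hst t : periodic N (st t) by move=> i; rewrite /st per_s per_h.
have small i : exists2 d, 0 < d & forall t, `|t| <= d ->
    0 <= st t i <= 1 /\ 0 <= 1 + t * m i.
  case/andP: (inner i) => s0 s1.
  have [d1 d10 h1] := small_mul (h i) s0.
  have s1' : 0 < 1 - s i by rewrite subr_gt0.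
  have [d2 d20 h2] := small_mul (h i) s1'.
  have [d3 d30 h3] := small_mul (m i) (@ltr01 R).
  exists (Num.min d1 (Num.min d2 d3)); first by rewrite !lt_min d10 d20.
  move=> t; rewrite !le_min => /and3P[/h1 t1 /h2 t2 /h3 t3].
  move: t1 t2 t3; rewrite !ler_norml /st => /andP[? ?] /andP[? ?] /andP[? ?].
  by split; lra.
have [d d0 hd] := small_for_all N small.
have N0 : (0 < N)%N by rewrite /N; lia.
have ust t : `|t| <= d -> unit_seq (st t).
  move=> ht i; rewrite -(periodic_mod i (hst t)).
  by have [] := hd t ht (i %% N)%N (ltn_pmod _ N0).
pose K := \sum_(0 <= i < N) m i * l i.
have FE t : `|t| <= d -> chain (pos p (st t)) 0 N = chain (pos p s) 0 N + t * K.
  move=> ht; rewrite /K mulr_sumr /chain -big_split; apply: eq_big_nat => i hi.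
  rewrite hm ger0_norm; first by rewrite /l /=; ring.
  by have [] := hd t ht i hi.
have nd : `|d| <= d by rewrite gtr0_norm.
have nNd : `|- d| <= d by rewrite normrN.
have K0 : K = 0.
  have := min_s (ust _ nd) (hst _); have := min_s (ust _ nNd) (hst _).
  rewrite !FE // !lerDl mulNr oppr_ge0 => h1 h2.
  have : d * K == 0 by rewrite eq_le h1.
  by rewrite mulf_eq0 (gt_eqF d0) => /eqP.
exists (st (- d)); split; [exact: ust | exact: hst | |].
  by rewrite FE // K0 mulr0 addr0.
rewrite /st gtrDl mulNr oppr_lt0 mulr_gt0 // /h expr0 mul1r.
exact: divr_gt0.
Qed.

End Interior.

(** The lexicographically least shortest path visits some [p j]; cut open there, it is bounded below
    by the potential [W] for that start. The value [j = 2 * n] occurs when the visit is the end of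
    the last side. *)
Lemma closed_path_bound (best : R) :
  (forall j, (j <= 2 * n)%N -> exists W : nat -> R, [/\ W j = 0,
     forall a b, (j <= a)%N -> (a < b)%N -> (b <= j + 2 * n)%N ->
       W b <= W a + piece_len p a b &
     best <= W (j + 2 * n)%N]) ->
  forall y, unit_seq y -> periodic (2 * n) y -> best <= chain (pos p y) 0 (2 * n).
Proof.
move=> hW; have N0 : (0 < 2 * n)%N by lia.
have [s [us ps smin]] := exists_lex_min p (2 * n).-1.
rewrite !prednK // in ps smin.
have {}smin s' us' ps' := smin s' us' ps'.
suff [j jN e] : exists2 j, (j <= 2 * n)%N &
    pos p s j = p j \/ pos p s (j + 2 * n).-1 = p (j + 2 * n)%N.
  move=> y uy py; apply: le_trans ((smin y uy py).1).
  rewrite -(closed_path_len (j := j)) //.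
  have [W [W0 hWj hb]] := hW j jN.
  apply: le_trans hb _; rewrite -[path_len _ _ _ _]add0r -W0.
  apply: (shortest_path cp (a0 := j) (b0 := (j + 2 * n)%N)) => //; first by lia.
  split=> // s' us'; rewrite closed_path_len //.
  (* The competitor [s'] need not be periodic: only its window from [j] is kept and repeated. The
     summand [(2 * n).-1 * j] stands for [- j] modulo [2 * n]. *)
  pose y' t := s' (j + (t + ((2 * n).-1 * j)) %% (2 * n))%N.
  have py' : periodic (2 * n) y'.
    by move=> t; rewrite /y' addnAC modnDr.
  apply: le_trans ((smin y' _ py').1) _; first by move=> t; exact: us'.
  apply: close_up => // t /andP[jt tj]; rewrite /y'.
  have -> : (t + (2 * n).-1 * j = j * (2 * n) + (t - j))%N.
    by rewrite [RHS]addnC -{1}(subnK jt) -addnA -mulSn prednK // mulnC.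
  by rewrite modnMDl modn_small ?subnKC //; lia.
case: (boolP [exists i : 'I_(2 * n), (s i <= 0) || (1 <= s i)]).
  move=> /existsP[i]; have iN := ltn_ord i; have /andP[s0 s1] := us i.
  case/orP=> hi.
    exists i; first exact: ltnW.
    have e0 : s i = 0 by apply/eqP; rewrite eq_le hi.
    by left; rewrite /pos e0 on_edge0.
  exists i.+1 => //; right.
  have e1 : s i = 1 by apply/eqP; rewrite eq_le s1.
  by rewrite addSn /= (periodic_pos per_p2 ps) /pos e1 on_edge1 -addSn per_p2.
move=> /existsPn none.
have inner i : 0 < s i < 1.
  rewrite -(periodic_mod i ps).
  have := none (Ordinal (ltn_pmod i N0)) => /=.
  by rewrite negb_or -!ltNge => /andP[-> ->].
have [s' [us' ps' le' lt']] :=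
  interior_not_lex_min ps inner (fun s' us' ps' => (smin s' us' ps').1).
by have := (smin s' us' ps').2 le'; rewrite leNgt lt'.
Qed.

(** Both rounds run along the same sides, so the averaged points are midpoints and [dist_convex]
    applies to each edge. The case [t = n] of the hypothesis serves the closing edge. *)
Lemma chain_average y z : periodic (2 * n) y ->
  (forall t, (t <= n)%N -> z t = (y t + y (t + n)%N) / 2) ->
  2 * chain (pos p z) 0 n <= chain (pos p y) 0 (2 * n).
Proof.
move=> py hz.
rewrite (@chain_cat _ _ 0 n (2 * n)); [|lia ..].
have -> : chain (pos p y) n (2 * n) = chain (fun t => pos p y (t + n)%N) 0 n.
  by rewrite /chain -{1}[n]add0n mul2n -addnn big_addn addnK; apply: eq_bigr.
have zE t : (t <= n)%N -> pos p z t = on_edge (pos p y t) (pos p y (t + n)) (1 / 2).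
  move=> tn; rewrite /pos hz // -addSn !per_p /on_edge /=.
  by congr (_, _); field.
rewrite /chain -big_split mulr_sumr /= !big_mkord; apply: ler_sum => t _.
have tn := ltn_ord t.
rewrite !zE ?(ltnW tn) //.
have h2 : 0 <= (1 / 2 : R) <= 1 by apply/andP; split; lra.
have := dist_convex (pos p y t) (pos p y (t + n)) (pos p y t.+1) (pos p y (t.+1 + n)) h2.
rewrite addSn; lra.
Qed.

Lemma chain_double y : periodic n y ->
  chain (pos p y) 0 (2 * n) = 2 * chain (pos p y) 0 n.
Proof.
move=> py; rewrite (@chain_cat _ _ 0 n (2 * n)); [|lia ..].
rewrite mul2n -addnn chain_rot; first by ring.
exact: periodic_pos.
Qed.

End ClosedPaths.

(** * Inscribed polygons and closed paths *)

Section LowerBound.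
Local Open Scope ring_scope.
Variable R : realType.
Implicit Types (C Q : seq (R * R)) (p q : nat -> R * R) (s z : nat -> R).

Lemma perimE C : perim C = chain (vertex C) 0 (size C).
Proof. by rewrite /chain big_mkord. Qed.

Lemma convex_seq_shift n p r : convex_seq n p -> convex_seq n (fun t => p (r + t)%N).
Proof.
case=> n3 per pos3; split=> // [i|i j k ij jk ki]; first by rewrite addnA per.
by apply: pos3; lia.
Qed.

Lemma vertex_periodic C : periodic (size C) (vertex C).
Proof. by move=> t; rewrite /vertex modnDr. Qed.

(* The chosen vertices of [Q], one on each side of [C], occur in [Q] in cyclic
   order, because a triple of them that turns left with respect to [C] turns
   left in [Q]. *)
Lemma inscribed_ge_chain Q C : inscribed Q C ->
  exists s, [/\ unit_seq s, periodic (size C) s &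
    chain (pos (vertex C) s) 0 (size C) <= perim Q].
Proof.
move=> [cQ cC hs]; set n := size C; set p := vertex C.
have cp : convex_seq n p := convex_polygon_seq cC.
have cq := convex_polygon_seq cQ; set m := size Q in cq *.
have n3 : (3 <= n)%N by case: cp.
have m3 : (3 <= m)%N by case: cq.
have per : periodic n p by exact: vertex_periodic.
have ex i : exists ks : nat * R, [/\ (ks.1 < m)%N, 0 <= ks.2 <= 1 &
    vertex Q ks.1 = on_edge (p i) (p i.+1) ks.2].
  have [|x xQ [t ht xE]] := hs (i %% n)%N; first by rewrite ltn_pmod //; lia.
  exists (index x Q, t); split=> //=; first by rewrite /m index_mem.
  rewrite /vertex modn_small ?index_mem // nth_index // xE /on_edge.
  by rewrite vertex_mod vertexS_mod.
have [f hf] := boolp.choice ex.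
pose s i := (f (i %% n)%N).2; pose sg i := (f (i %% n)%N).1.
have us : unit_seq s by move=> i; case: (hf (i %% n)%N).
have ps : periodic n s by move=> i; rewrite /s modnDr.
have sm i : (sg i < m)%N by case: (hf (i %% n)%N).
have sE i : vertex Q (sg i) = pos p s i.
  case: (hf (i %% n)%N) => _ _ ->; rewrite /pos.
  by rewrite (periodic_mod i per) /p vertexS_mod.
exists s; split=> //.
pose r := sg 0%N; pose q t := vertex Q (r + t).
have {}cq : convex_seq m q by exact: convex_seq_shift.
have pq : periodic m q by case: cq.
have rm : (r < m)%N by exact: sm.
pose tau i := ((sg i + (m - r)) %% m)%N.
have taum i : (tau i < m)%N by rewrite ltn_pmod //; lia.
have tauE i : q (tau i) = pos p s i.
  rewrite /q -sE /vertex /tau -/m modnDmr.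
  by rewrite addnCA subnKC ?(ltnW rm) // modnDr.
have tau0 : tau 0%N = 0%N by rewrite /tau -/r subnKC ?(ltnW rm) // modnn.
(* [tau] counts positions in [Q] from the vertex chosen on side 0. The closing index [n] must count
   as a full turn [m], and so must [n.-1] if its vertex is the one chosen on side 0; otherwise [T]
   would drop back to 0. *)
pose T i := if (i == n) || ((i == n.-1) && (tau i == 0%N)) then m else tau i.
have TE i : (i <= n)%N -> q (T i) = pos p s i.
  rewrite /T => _; case: ifP => [h|_]; last exact: tauE.
  rewrite -[m]add0n pq -tau0 tauE.
  case/orP: h => [/eqP ->|/andP[_ /eqP ti]].
    by rewrite -[n in RHS]add0n periodic_pos.
  by rewrite -!tauE tau0 ti.
have Tm i : (T i <= m)%N by rewrite /T; case: ifP => // _; exact: ltnW.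
have Tmono i : (i < n)%N -> (T i <= T i.+1)%N.
  move=> ilt; case: (posnP i) => [->|i0].
    have -> : T 0%N = 0%N; last by [].
    by rewrite /T tau0; case: ifP => // h; lia.
  have [->|in1] := eqVneq i n.-1.
    by rewrite [T n.-1.+1]/T prednK ?eqxx ?Tm //; lia.
  have -> : T i = tau i by rewrite /T; case: ifP => // h; lia.
  rewrite /T; case: ifP => [_|hn]; first exact: ltnW.
  rewrite leqNgt; apply/negP => lt.
  (* Position 0 is impossible here: side [i.+1] is not adjacent to side 0, hence lies strictly to
     its left and shares no point with it. *)
  case: (posnP (tau i.+1)) => [t0|tpos].
    have := tauE i.+1; rewrite t0 -tau0 tauE => e0.
    have cp' := cp; case: cp' => _ _ pos3.
    have /mix_gt0 h : 0 <= (0 : R) < 1 by rewrite lexx ltr01.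
    have h1 : 0 < orient (p 0%N) (p 1%N) (p i.+1) by apply: pos3; lia.
    have h2 : 0 < orient (p 0%N) (p 1%N) (p i.+2) by apply: pos3; lia.
    have := orient_edge_same (p 0%N) (p 1%N) (s 0%N).
    rewrite -[on_edge _ _ _]/(pos p s 0) e0 orient_edge.
    have /andP[s0 s1] := us i.+1; nra.
  have o1 : 0 < orient (q 0%N) (q (tau i.+1)) (q (tau i)).
    by case: cq => _ _; apply.
  have : 0 <= orient (pos p s 0) (pos p s i) (pos p s i.+1).
    by apply: (orient_sides_ge0 cp); rewrite ?us //; lia.
  by rewrite orient_anti -!tauE tau0; lra.
have main i : (i <= n)%N -> chain (pos p s) 0 i <= chain q 0 (T i).
  elim: i => [|i IH] hi; first by rewrite chain_nil chain_ge0.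
  rewrite (@chain_cat _ _ 0 i) // chain1 (@chain_cat _ q 0 (T i)) ?Tmono //.
  apply: lerD; first exact: IH (ltnW hi).
  by rewrite -!TE ?(ltnW hi) // dist_le_chain // Tmono.
apply: le_trans (main n (leqnn n)) _.
rewrite /T eqxx /= perimE -/m -(chain_rot r (@vertex_periodic Q)) -/m.
suff -> : chain (vertex Q) r (r + m) = chain q 0 m by [].
rewrite /chain -{1}[r]add0n big_addn addKn; apply: eq_bigr => i _.
by rewrite /q addnS addnC.
Qed.

End LowerBound.

(** * From a closed path to a convex polygon *)

Section Emission.
Local Open Scope ring_scope.
Variable R : realType.
Implicit Types (C Q : seq (R * R)) (p q : nat -> R * R) (s z : nat -> R).

Fixpoint polyline (x : R * R) (l : seq (R * R)) : R :=
  if l is y :: l' then dist x y + polyline y l' else 0.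

Lemma polylineE x l :
  polyline x l = \sum_(i < size l) dist (nth (0, 0) (x :: l) i) (nth (0, 0) l i).
Proof.
elim: l x => [|y l IH] x; first by rewrite big_ord0.
by rewrite /= big_ord_recl IH.
Qed.

Lemma polyline_rcons x l y : polyline x (rcons l y) = polyline x l + dist (last x l) y.
Proof. by elim: l x => [|u l IH] x /=; rewrite ?addr0 ?add0r // IH addrA. Qed.

Lemma perim_polyline x0 Q : perim Q = polyline (last x0 Q) Q.
Proof.
case: Q => [|y l]; first by rewrite /perim big_ord0.
rewrite [RHS]/= addrC -polyline_rcons polylineE size_rcons.
rewrite /perim [size (y :: l)]/=; apply: eq_bigr => i _.
have il := ltn_ord i; rewrite /vertex /= modn_small //.
congr dist; first by rewrite -rcons_cons nth_rcons /= ltnS -ltnS il.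
rewrite nth_rcons; case: (ltngtP i (size l)) => h; last by rewrite h modnn.
  by rewrite modn_small.
by move: il h; lia.
Qed.

Variables (n : nat) (p : nat -> R * R).
Hypothesis cp : convex_seq n p.
Let n3 : (3 <= n)%N. Proof. by case: cp. Qed.
Let per_p : periodic n p. Proof. by case: cp. Qed.

Variable z : nat -> R.
Hypotheses (uz : unit_seq z) (pz : periodic n z).
Hypothesis normal : forall i, z i = 1 -> z i.+1 = 0.

(* [z (i - 1) = 1] means that the path is already at [p i], where it stays by
   [normal]. *)
Definition kept i := ~~ (1 <= z (i + n).-1).

Let keptS i : kept i.+1 = ~~ (1 <= z i).
Proof. by rewrite /kept addSn /= pz. Qed.

Let kept_per : periodic n kept.
Proof.
move=> i; rewrite /kept; have -> : (i + n + n).-1 = ((i + n).-1 + n)%N by lia.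
by rewrite pz.
Qed.

(** If [i] is dropped then [z i.-1 = 1] cyclically, so [z i = 0] by [normal], and [i.+1] is kept. *)
Let kept_or i : kept i || kept i.+1.
Proof.
rewrite keptS /kept -negb_and; apply/negP => /andP[h1 h2].
have e1 : z (i + n).-1 = 1 by apply/eqP; rewrite eq_le h1; case/andP: (uz (i + n).-1) => _ ->.
have := normal e1; rewrite prednK; last by lia.
by rewrite pz => e; move: h2; rewrite e ler10.
Qed.

Let not_kept i : ~~ kept i -> pos p z i = p i /\ pos p z (i + n).-1 = p i.
Proof.
rewrite negbK => h1.
have e1 : z (i + n).-1 = 1 by apply/eqP; rewrite eq_le h1; case/andP: (uz (i + n).-1) => _ ->.
have nS : (i + n).-1.+1 = (i + n)%N by rewrite prednK //; lia.
have := normal e1; rewrite nS pz => e2.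
by rewrite /pos e1 e2 on_edge0 on_edge1 nS per_p.
Qed.

Definition kept_points k := [seq pos p z i | i <- iota 0 k & kept i].

Lemma kept_pointsS k :
  kept_points k.+1 = if kept k then rcons (kept_points k) (pos p z k) else kept_points k.
Proof.
rewrite /kept_points -addn1 iotaD filter_cat map_cat /= add0n.
by case: ifP => _ /=; rewrite ?cats1 ?cats0.
Qed.

Lemma perim_kept_points : perim (kept_points n) = chain (pos p z) 0 n.
Proof.
pose x0 := pos p z n.-1.
(* A dropped point repeats its predecessor, so the last kept point always coincides with the latest
   point of the path. Starting from [x0], the last point of the path, accounts for the closing
   edge. *)
have H k : (k <= n)%N ->
    polyline x0 (kept_points k) =
      (if k is k'.+1 then dist x0 (pos p z 0) + chain (pos p z) 0 k' else 0) /\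
    last x0 (kept_points k) = if k is k'.+1 then pos p z k' else x0.
  elim: k => [//|k IH] kn; have [IH1 IH2] := IH (ltnW kn).
  have eb : last x0 (kept_points k) = pos p z (k + n).-1.
    rewrite IH2; case: (k) => [|k'] //.
    by rewrite addSn /= periodic_pos.
  have len : polyline x0 (kept_points k) + dist (last x0 (kept_points k)) (pos p z k) =
      dist x0 (pos p z 0) + chain (pos p z) 0 k.
    rewrite IH1 IH2; case: (k) => [|k']; first by rewrite chain_nil addr0 add0r.
    by rewrite (@chain_cat _ _ 0 k' k'.+1) // chain1 addrA.
  rewrite kept_pointsS; case: ifP => [_|/negbT /not_kept [e1 e2]].
    by rewrite polyline_rcons len last_rcons.
  by rewrite -len eb e1 e2 distxx addr0.
have en : n.-1.+1 = n by rewrite prednK //; lia.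
have [|h1 h2] := H n.-1.+1; first by rewrite en.
rewrite en in h1 h2; rewrite (perim_polyline x0) h2 h1 -[in RHS]en.
rewrite (@chain_cat _ _ 0 n.-1 n.-1.+1) // chain1 addrC /x0 en.
by have := periodic_pos per_p pz 0; rewrite add0n => ->.
Qed.

(** Three points remain by [kept_or] and [5 <= n]. A point at the far end of its side is attributed
    to the next side; the kept points then sit on distinct half-open sides and [orient_sides_gt0]
    applies. *)
Lemma kept_points_convex : (5 <= n)%N -> convex_polygon (kept_points n).
Proof.
move=> n5; set F := [seq i <- iota 0 n | kept i].
have kn0 : kept n.-1 || kept 0.
  have := kept_or n.-1; rewrite prednK; last by lia.
  by have := kept_per 0; rewrite add0n => ->.
have size3 : (3 <= size F)%N.
  have memF i : (i < n)%N -> kept i -> i \in F.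
    by move=> h1 h2; rewrite mem_filter h2 mem_iota.
  have three a b c : (a < b)%N -> (b < c)%N -> (c < n)%N -> kept a -> kept b -> kept c ->
      (3 <= size F)%N.
    move=> ab bc cn ka kb kc.
    apply: (@uniq_leq_size _ [:: a; b; c]).
      by rewrite /= !inE; lia.
    by move=> i; rewrite !inE => /or3P[] /eqP ->; apply: memF => //; lia.
  have k01 := kept_or 0; have k12 := kept_or 1; have k23 := kept_or 2.
  have k34 := kept_or 3.
  case k4: (kept 4).
    case/orP: k01 => ka; case/orP: k23 => kb;
      by apply: (three _ _ _ _ _ _ ka kb k4).
  rewrite k4 orbF in k34.
  have [e|n6] := eqVneq n 5.
    rewrite e /= k4 /= in kn0.
    by case/orP: k12 => kb; apply: (three _ _ _ _ _ _ kn0 kb k34) => //; lia.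
  have k5 : kept 5 by have := kept_or 4; rewrite k4.
  by case/orP: k01 => ka; apply: (three _ _ _ _ _ _ ka k34 k5) => //; lia.
apply: seq_convex_polygon; rewrite size_map -/F // => i j k ij jk kF.
have jF := ltn_trans jk kF; have iF := ltn_trans ij jF.
rewrite !(nth_map 0%N) //.
have sF : sorted ltn F by apply: sorted_filter (iota_ltn_sorted _ _) => ? ? ?; exact: ltn_trans.
have inF t : (t < size F)%N -> kept (nth 0%N F t) /\ (nth 0%N F t < n)%N.
  move=> tF; have := mem_nth 0%N tF; rewrite mem_filter mem_iota add0n.
  by case/andP.
have lt t u : (t < u)%N -> (u < size F)%N -> (nth 0%N F t < nth 0%N F u)%N.
  move=> tu uF; apply: (sorted_ltn_nth ltn_trans 0%N sF) => //=.
  by rewrite inE (ltn_trans tu).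
have [ki iln] := inF i iF; have [kj jln] := inF j jF; have [kk kln] := inF k kF.
have lij := lt i j ij jF; have ljk := lt j k jk kF.
clear ij jk iF jF kF lt.
move: (nth 0%N F i) (nth 0%N F j) (nth 0%N F k) lij ljk ki kj kk iln jln kln.
move=> {}i {}j {}k ij jk ki kj kk iln jln kln.
(* kept points lie on distinct half-open sides [m] *)
have half t : exists m u, [/\ pos p z t = on_edge (p m) (p m.+1) u, 0 <= u < 1,
    (t <= m <= t.+1)%N & m = t.+1 -> 1 <= z t].
  case: (lerP 1 (z t)) => h.
    exists t.+1, 0; rewrite lexx ltr01 leqnSn leqnn; split=> //.
    have e1 : z t = 1 by apply/eqP; rewrite eq_le h; case/andP: (uz t) => _ ->.
    by rewrite on_edge0 /pos e1 on_edge1.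
  exists t, (z t); rewrite h leqnn leqnSn; split=> //; last by lia.
  by case/andP: (uz t) => ->.
(* A point attributed to side [t.+1] sits at [p t.+1], and then index [t.+1] is not kept; so
   attributed sides keep the strict order of the indices. *)
have next t t' m : (t < t')%N -> kept t' -> (m = t.+1 -> 1 <= z t) -> (t <= m <= t.+1)%N ->
    (m < t')%N.
  move=> tt kt' hm /andP[m1 m2]; rewrite leqNgt ltnS; apply/negP => t'm.
  have mt : m = t.+1 by apply/eqP; rewrite eqn_leq m2 (leq_trans tt t'm).
  have e : t' = t.+1 by apply/eqP; rewrite eqn_leq tt -mt t'm.
  by move: kt'; rewrite e keptS hm.
have [mi [ui [-> hui mi1 mi2]]] := half i.
have [mj [uj [-> huj mj1 mj2]]] := half j.
have [mk [uk [-> huk mk1 mk2]]] := half k.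
have h1 := next _ _ _ ij kj mi2 mi1; have h2 := next _ _ _ jk kk mj2 mj1.
have ij' : (mi < mj)%N by case/andP: mj1 => h _; exact: leq_trans h1 h.
have jk' : (mj < mk)%N by case/andP: mk1 => h _; exact: leq_trans h2 h.
apply: (orient_sides_gt0 cp) => //.
have [imi _] := andP mi1; have [_ mkk] := andP mk1.
have [i0|i0] := posnP i; last first.
  apply: (leq_trans (n := n.+1)); first exact: leq_trans mkk kln.
  by rewrite -add1n leq_add2r (leq_trans i0).
(* Wrap-around: a last point attributed to side [n] would be at [p 0], in which case index 0 would
   have been dropped. *)
have [mkn|mkn] := eqVneq mk n.
  have mkE : mk = k.+1 by apply/eqP; rewrite eqn_leq mkk mkn kln.
  by move: ki; rewrite i0 /kept add0n -mkn mkE /= mk2.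
have mkln : (mk < n)%N by rewrite ltn_neqAle mkn (leq_trans mkk kln).
exact: leq_trans mkln (leq_addl _ _).
Qed.

(** For a dropped [i] the point [p i] is the path point of the preceding index, which is kept by
    [kept_or]. *)
Lemma kept_points_cover i : (i < n)%N ->
  exists2 x, x \in kept_points n & segment (p i) (p i.+1) x.
Proof.
move=> ilt; case ki: (kept i).
  exists (pos p z i); last by exists (z i).
  by apply/map_f; rewrite mem_filter ki mem_iota.
move/negbT: ki => ki; have [_ e] := not_kept ki.
exists (p i); last by exists 0; rewrite ?lexx ?ler01 // -[RHS]/(on_edge _ _ _) on_edge0.
have n0 : (0 < n)%N by lia.
rewrite -e -(periodic_mod (i + n).-1 (periodic_pos per_p pz)); apply: map_f.
rewrite mem_filter mem_iota ltn_pmod // (periodic_mod _ kept_per) leq0n !andbT.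
have := kept_or (i + n).-1; case/orP => //.
by rewrite prednK ?kept_per ?(negPf ki) //; lia.
Qed.

End Emission.

(** * Optimality of the emitted polygon *)

Section Output.
Local Open Scope ring_scope.
Variable R : realType.
Implicit Types (C Q : seq (R * R)) (p q : nat -> R * R) (s z : nat -> R).

Definition cyclic (T : Type) n (z : nat -> T) t := z (t %% n)%N.

Lemma cyclic_periodic (T : Type) n (z : nat -> T) : periodic n (cyclic n z).
Proof. by move=> t; rewrite /cyclic modnDr. Qed.

(** The previous point is already at [p i]; joining it there makes one edge vanish, and the triangle
    inequality bounds the other. *)
Lemma chain_vertex_update n p z i : convex_seq n p -> (i < n)%N ->
  z ((i + n).-1 %% n)%N = 1 ->
  chain (pos p (cyclic n (upd z i 0))) 0 n <= chain (pos p (cyclic n z)) 0 n.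
Proof.
move=> [n3 per_p _] ilt zi; set y := cyclic n z; set y' := cyclic n _.
have n0 : (0 < n)%N by lia.
have nS : (i + n).-1.+1 = (i + n)%N by rewrite prednK //; lia.
have py : periodic n (pos p y) by apply: periodic_pos per_p (@cyclic_periodic _ n z).
have py' : periodic n (pos p y') by apply: periodic_pos per_p (@cyclic_periodic _ n _).
rewrite -(chain_rot (i + n).-1 py) -(chain_rot (i + n).-1 py').
have c1 : ((i + n).-1 < i + n)%N by rewrite -{2}nS.
have c2 : (i + n < (i + n).-1 + n)%N by lia.
rewrite !(chain_at _ c1 c2) !chain_nil !add0r.
have ynear t : (t %% n != i)%N -> pos p y' t = pos p y t.
  by move=> ti; rewrite /pos /y' /y /cyclic /upd (negPf ti).
have -> : pos p y' (i + n) = p i.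
  by rewrite py' /pos /y' /cyclic /upd modn_small // eqxx on_edge0.
have ne t : (i < t)%N -> (t < i + n)%N -> (t %% n != i)%N.
  by move=> h1 h2; rewrite -[X in _ != X](modn_small ilt) neq_mod_close.
have prev : pos p y (i + n).-1 = p i.
  by rewrite /pos /y /cyclic zi on_edge1 nS per_p.
rewrite (ynear (i + n).-1); last by apply: ne; lia.
rewrite (@eq_chain _ (pos p y') (pos p y)); last first.
  by move=> t ht; apply: ynear; rewrite -(subnK (n := t) (m := n)) ?modnDr; [apply: ne|]; lia.
rewrite (ynear (i + n).+1); last by rewrite -addSn modnDr ne //; lia.
rewrite prev distxx add0r lerD2r; exact: dist_triangle.
Qed.

Lemma optimal_output C z : (5 <= size C)%N -> convex_polygon C ->
  unit_seq z -> periodic (size C) z -> (forall i, z i = 1 -> z i.+1 = 0) ->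
  (forall y, unit_seq y -> periodic (size C) y ->
     chain (pos (vertex C) z) 0 (size C) <= chain (pos (vertex C) y) 0 (size C)) ->
  min_perim_inscribed (kept_points (size C) (vertex C) z (size C)) C.
Proof.
move=> n5 cC uz pz normal zmin.
have cp := convex_polygon_seq cC.
set E := kept_points _ _ _ _.
have iE : inscribed E C.
  split=> //; first exact: kept_points_convex.
  by move=> i iC; apply: kept_points_cover.
split=> //; apply/eqP; rewrite eq_le; apply/andP; split; last first.
  apply: ge_inf; last by exists E.
  exists 0 => _ [Q _ <-]; rewrite perimE; exact: chain_ge0.
apply: lb_le_inf; first by exists (perim E), E.
move=> _ [Q iQ <-]; have [s [us ps]] := inscribed_ge_chain iQ.
by apply: le_trans; rewrite perim_kept_points // zmin.
Qed.

End Output.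

(** * Total correctness with time bounds *)

Section ProgramLogic.
Variable R : realType.
Implicit Types (P : cmd) (s : state R) (Q : state R -> Prop).

Definition runs P s T Q := exists t s', [/\ exec P s t s', t <= T & Q s'].

Lemma runs_weaken P s T T' Q Q' : runs P s T Q -> T <= T' ->
  (forall s', Q s' -> Q' s') -> runs P s T' Q'.
Proof.
move=> [t [s' [e h q]]] TT QQ; exists t, s'; split=> //; first exact: leq_trans TT.
exact: QQ.
Qed.

Lemma runs_seq P1 P2 s T1 T2 Q :
  runs P1 s T1 (fun s1 => runs P2 s1 T2 Q) -> runs (Seq P1 P2) s (T1 + T2) Q.
Proof.
move=> [t1 [s1 [e1 h1 [t2 [s2 [e2 h2 q]]]]]]; exists (t1 + t2), s2; split=> //.
  exact: ExecSeq e1 e2.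
exact: leq_add.
Qed.

Fixpoint loop_free P : bool :=
  match P with
  | Seq P1 P2 | If _ P1 P2 => loop_free P1 && loop_free P2
  | While _ _ => false
  | _ => true
  end.

Fixpoint run P s : state R :=
  match P with
  | NSet a i e => State (update (nmem s) a (neval s i) (neval s e)) (rmem s)
  | RSet a i e => State (nmem s) (update (rmem s) a (neval s i) (reval s e))
  | Seq P1 P2 => run P2 (run P1 s)
  | If b P1 P2 => if beval s b then run P1 s else run P2 s
  | _ => s
  end.

Lemma run_seq P1 P2 s : run (Seq P1 P2) s = run P2 (run P1 s).
Proof. by []. Qed.

Fixpoint cost_bound P : nat :=
  match P with
  | Skip => 1
  | NSet _ i e => (ncost i + ncost e).+1
  | RSet _ i e => (ncost i + rcost e).+1
  | Seq P1 P2 => cost_bound P1 + cost_bound P2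
  | If b P1 P2 => (bcost b + maxn (cost_bound P1) (cost_bound P2)).+1
  | While _ _ => 0
  end.

Lemma runs_loop_free P s T Q : loop_free P -> cost_bound P <= T -> Q (run P s) -> runs P s T Q.
Proof.
move=> lf cT q; suff [t e h] : exists2 t, exec P s t (run P s) & t <= cost_bound P.
  by exists t, (run P s); split=> //; apply: leq_trans cT.
elim: P s lf {cT q} => [|a i e|a i e|P1 IH1 P2 IH2|b P1 IH1 P2 IH2|//] s /=.
- by exists 1 => //; constructor.
- by move=> _; eexists; first exact: ExecNSet.
- by move=> _; eexists; first exact: ExecRSet.
- move=> /andP[/(IH1 s) [t1 e1 h1] /(IH2 (run P1 s)) [t2 e2 h2]].
  by exists (t1 + t2); [exact: ExecSeq e1 e2 | exact: leq_add].
move=> /andP[/(IH1 s) [t1 e1 h1] /(IH2 s) [t2 e2 h2]].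
case: ifPn => hb.
  exists (bcost b + t1).+1; first exact: ExecIfTrue.
  by rewrite ltnS leq_add2l leq_max h1.
exists (bcost b + t2).+1; first exact: ExecIfFalse.
by rewrite ltnS leq_add2l leq_max h2 orbT.
Qed.

Lemma runs_if b P1 P2 s T Q : runs (if beval s b then P1 else P2) s T Q ->
  runs (If b P1 P2) s (bcost b + T).+1 Q.
Proof.
move=> [t [s' [e h q]]]; exists (bcost b + t).+1, s'; split=> //; last by rewrite ltnS leq_add2l.
by case: ifPn e => hb e; [exact: ExecIfTrue | exact: ExecIfFalse].
Qed.

Lemma runs_while b P s m T (I : nat -> state R -> Prop) :
  I 0 s ->
  (forall k s, k < m -> I k s -> beval s b /\ runs P s T (I k.+1)) ->
  (forall s, I m s -> ~~ beval s b) ->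
  runs (While b P) s (m * (bcost b + T).+1 + (bcost b).+1) (I m).
Proof.
move=> I0 step stop.
have H k : k <= m -> forall s, I (m - k) s ->
    runs (While b P) s (k * (bcost b + T).+1 + (bcost b).+1) (I m).
  elim: k => [|k IH] km s' Is.
    rewrite subn0 in Is; exists (bcost b).+1, s'; split=> //.
    by apply: ExecWhileFalse; exact: stop.
  have lt : m - k.+1 < m by rewrite ltn_subrL; lia.
  have [hb [t1 [s1 [e1 h1 Is1]]]] := step _ _ lt Is.
  have e : (m - k.+1).+1 = m - k by lia.
  rewrite e in Is1; have [t2 [s2 [e2 h2 Is2]]] := IH (ltnW km) _ Is1.
  exists (bcost b + t1 + t2).+1, s2; split=> //; first exact: ExecWhileTrue e1 e2.
  by rewrite mulSn -[leqRHS]addnA addSn ltnS leq_add // leq_add2l.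
by apply: H => //; rewrite subnn.
Qed.

Fixpoint nwrites P : seq nat :=
  match P with
  | NSet a _ _ => [:: a]
  | Seq P1 P2 | If _ P1 P2 => nwrites P1 ++ nwrites P2
  | While _ P1 => nwrites P1
  | _ => [::]
  end.

Fixpoint rwrites P : seq nat :=
  match P with
  | RSet a _ _ => [:: a]
  | Seq P1 P2 | If _ P1 P2 => rwrites P1 ++ rwrites P2
  | While _ P1 => rwrites P1
  | _ => [::]
  end.

(** Framing is per array and read off the program text; specifications need to describe unchanged
    cells only within arrays that are written. *)
Definition frame P s s' :=
  (forall a, a \notin nwrites P -> nmem s' a = nmem s a) /\
  (forall a, a \notin rwrites P -> rmem s' a = rmem s a).

Lemma exec_frame P s t s' : exec P s t s' -> frame P s s'.
Proof.
elim=> {P s t s'} /=.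
- by split.
- move=> s a i e; split=> //= b; rewrite inE => /negPf ab.
  by apply: boolp.funext => j; rewrite /update ab.
- move=> s a i e; split=> //= b; rewrite inE => /negPf ab.
  by apply: boolp.funext => j; rewrite /update ab.
- move=> s s1 s2 P1 P2 t1 t2 _ [n1 r1] _ [n2 r2]; split=> a /=; rewrite mem_cat negb_or.
    by move=> /andP[a1 a2]; rewrite n2 ?n1.
  by move=> /andP[a1 a2]; rewrite r2 ?r1.
- move=> s s' b P1 P2 t _ _ [n1 r1]; split=> a /=; rewrite mem_cat negb_or => /andP[a1 _].
    exact: n1.
  exact: r1.
- move=> s s' b P1 P2 t _ _ [n1 r1]; split=> a /=; rewrite mem_cat negb_or => /andP[_ a1].
    exact: n1.
  exact: r1.
- by split.
- move=> s s1 s2 b P t1 t2 _ _ [n1 r1] _ [n2 r2]; split=> a /= h.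
    by rewrite n2 ?n1.
  by rewrite r2 ?r1.
Qed.

Lemma runs_frame P s T Q : runs P s T Q -> runs P s T (fun s' => frame P s s' /\ Q s').
Proof. by move=> [t [s' [e h q]]]; exists t, s'; split=> //; split=> //; exact: exec_frame e. Qed.

(** All bounds have the form [c * x] with [x] a product of loop lengths. Constants simply add up, so
    a specification opened by [eexists] finds its constant by unification as the program is
    traversed. *)
Lemma runs_seqO P1 P2 s c1 c2 x Q : runs P1 s (c1 * x) (fun s1 => runs P2 s1 (c2 * x) Q) ->
  runs (Seq P1 P2) s ((c1 + c2) * x) Q.
Proof. by rewrite mulnDl; exact: runs_seq. Qed.

Lemma runs_basicO P s x Q : loop_free P -> 0 < x -> Q (run P s) ->
  runs P s (cost_bound P * x) Q.
Proof. by move=> lf x0; apply: runs_loop_free => //; rewrite leq_pmulr. Qed.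

Lemma runs_ifO b P1 P2 s c1 c2 x Q : 0 < x ->
  (beval s b -> runs P1 s (c1 * x) Q) -> (~~ beval s b -> runs P2 s (c2 * x) Q) ->
  runs (If b P1 P2) s ((bcost b + (c1 + c2)).+1 * x) Q.
Proof.
move=> x0 h1 h2; apply: runs_weaken (@runs_if b P1 P2 s ((c1 + c2) * x) Q _) _ (fun _ h => h).
  case: ifPn => [/h1|/h2] h; apply: runs_weaken h _ (fun _ h => h).
    by rewrite leq_mul2r leq_addr orbT.
  by rewrite leq_mul2r leq_addl orbT.
rewrite mulSn; apply: (@leq_add 1) => //; rewrite [leqRHS]mulnDl leq_add // leq_pmulr //.
Qed.

Lemma frame_refl P s : frame P s s. Proof. by []. Qed.

Lemma frame_trans P s s1 s2 : frame P s s1 -> frame P s1 s2 -> frame P s s2.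
Proof.
move=> [n1 r1] [n2 r2]; split=> a h; first by rewrite n2 ?n1.
by rewrite r2 ?r1.
Qed.

Lemma runs_whileO b P s m c1 c2 x y (I : nat -> state R -> Prop) :
  m <= c1 * y -> 0 < y -> 0 < x ->
  I 0 s ->
  (forall k s', k < m -> frame P s s' -> I k s' ->
     beval s' b /\ runs P s' (c2 * x) (I k.+1)) ->
  (forall s', frame P s s' -> I m s' -> ~~ beval s' b) ->
  runs (While b P) s ((c1 * (bcost b + c2).+1 + (bcost b).+1) * (y * x))
    (fun s' => frame P s s' /\ I m s').
Proof.
move=> my y0 x0 I0 step stop.
have := @runs_while b P s m (c2 * x) (fun k s' => frame P s s' /\ I k s').
move=> /(_ _ _ _)/runs_weaken; apply=> //.
- move=> k s' km [F Is]; have [hb hr] := step k s' km F Is; split=> //.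
  apply: runs_weaken (runs_frame hr) (leqnn _) _ => s'' [F' Is'].
  by split=> //; exact: frame_trans F F'.
- by move=> s' [F Is]; exact: stop.
rewrite mulnDl leq_add //; last by rewrite leq_pmulr // muln_gt0 y0.
rewrite mulnACA leq_mul // mulSn -add1n leq_add // mulnDl leq_add //.
by rewrite leq_pmulr.
Qed.

(** For [trace_cmd], whose number of rounds depends on the stored predecessors and is bounded only
    through a decreasing index. *)
Lemma runs_while_measureO b P s m c1 c2 x y (mu : state R -> nat) (I : state R -> Prop) :
  m <= c1 * y -> 0 < y -> 0 < x ->
  mu s <= m -> I s ->
  (forall s', frame P s s' -> I s' -> beval s' b ->
     runs P s' (c2 * x) (fun s'' => I s'' /\ mu s'' < mu s')) ->
  runs (While b P) s ((c1 * (bcost b + c2).+1 + (bcost b).+1) * (y * x))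
    (fun s' => [/\ frame P s s', I s' & ~~ beval s' b]).
Proof.
move=> my y0 x0 mum I0 step.
suff H : forall k s', mu s' <= k -> frame P s s' -> I s' ->
    runs (While b P) s' (k * (bcost b + c2 * x).+1 + (bcost b).+1)
      (fun s' => [/\ frame P s s', I s' & ~~ beval s' b]).
  apply: runs_weaken (H m s mum (frame_refl _ _) I0) _ (fun _ h => h).
  rewrite mulnDl leq_add //; last by rewrite leq_pmulr // muln_gt0 y0.
  rewrite mulnACA leq_mul // mulSn -add1n leq_add // mulnDl leq_add //.
  by rewrite leq_pmulr.
elim=> [|k IH] s' mk F Is.
  case hb: (beval s' b).
    have [t [s1 [_ _ [_]]]] := step _ F Is hb.
    by move: mk; rewrite leqn0 => /eqP ->.
  exists (bcost b).+1, s'; split=> //; first by apply: ExecWhileFalse; rewrite hb.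
  by rewrite hb.
case hb: (beval s' b); last first.
  exists (bcost b).+1, s'; split=> //; last by rewrite hb.
    by apply: ExecWhileFalse; rewrite hb.
  by rewrite leq_addl.
have [t1 [s1 [e1 h1 [F1 [Is1 mu1]]]]] := runs_frame (step _ F Is hb).
have mk1 : mu s1 <= k by rewrite -ltnS; apply: leq_trans mu1 mk.
have [t2 [s2 [e2 h2 q]]] := IH _ mk1 (frame_trans F F1) Is1.
exists (bcost b + t1 + t2).+1, s2; split=> //; first exact: ExecWhileTrue e1 e2.
by rewrite mulSn -[leqRHS]addnA addSn ltnS leq_add // leq_add2l.
Qed.

End ProgramLogic.

(** * The program *)

Notation nvar a := (NGet a (NConst 0)).
Notation nset a e := (NSet a (NConst 0) e).
Notation rvar a := (RGet a (NConst 0)).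
Notation rset a e := (RSet a (NConst 0) e).
Notation nsucc e := (NAdd e (NConst 1)).

Section Expressions.
Variable R : realType.
Implicit Types (s : state R).
Local Open Scope ring_scope.

Definition dist_expr (ax ay bx by_ : rexpr) : rexpr :=
  RSqrt (RAdd (RMul (RSub bx ax) (RSub bx ax)) (RMul (RSub by_ ay) (RSub by_ ay))).

Definition edge_expr (a b t : rexpr) : rexpr := RAdd a (RMul t (RSub b a)).

Definition mirror_coef (px py qx qy tx ty : rexpr) : rexpr :=
  RDiv (RMul (RConst 2) (RAdd (RMul (RSub tx px) (RSub qx px)) (RMul (RSub ty py) (RSub qy py))))
    (RAdd (RMul (RSub qx px) (RSub qx px)) (RMul (RSub qy py) (RSub qy py))).

Definition mirror_x px py qx qy tx ty : rexpr :=
  RSub (RAdd px (RMul (mirror_coef px py qx qy tx ty) (RSub qx px))) (RSub tx px).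

Definition mirror_y px py qx qy tx ty : rexpr :=
  RSub (RAdd py (RMul (mirror_coef px py qx qy tx ty) (RSub qy py))) (RSub ty py).

Definition crossing_expr (px py qx qy cx cy tx ty : rexpr) : rexpr :=
  RDiv (RSub (RMul (RSub tx cx) (RSub cy py)) (RMul (RSub ty cy) (RSub cx px)))
       (RSub (RMul (RSub tx cx) (RSub qy py)) (RMul (RSub ty cy) (RSub qx px))).

Lemma reval_crossing s px py qx qy cx cy tx ty :
  reval s (crossing_expr px py qx qy cx cy tx ty) =
  crossing (reval s px, reval s py) (reval s qx, reval s qy)
    (reval s cx, reval s cy) (reval s tx, reval s ty).
Proof. by []. Qed.

Definition clamp_expr (e : rexpr) : rexpr :=
  RDiv (RSub (RAdd (RConst 1) (RSqrt (RMul e e)))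
             (RSqrt (RMul (RSub e (RConst 1)) (RSub e (RConst 1))))) (RConst 2).

Lemma reval_clamp s e : reval s (clamp_expr e) = clamp (reval s e).
Proof. by []. Qed.

End Expressions.

(* Index variables: 0 and 12 hold [n] and the output size, 1 and 2 hold [2 n] and
   [4 n], 4 and 5 the ends [a], [b] of a piece, 6 its current side, 7 the first
   vertex [j], 8 and 9 the indices of the dynamic program, 11 a counter.  Array 3
   holds the multiples of [4 n + 1], array 10 the predecessors.
   Reals: 0 and 1 hold the polygon, 2 and 3 the unfolded images of [p b], 4 the
   parameters of the path, 5 the table of [piece_len], 6 the dynamic program, 7
   the best solution, 8, 9 and 10 the current point and length of a piece, 11
   twice a bound on the length of the best solution, 12 the previous parameter,
   13 and 14 the next point. *)
Definition unfold_loop : cmd :=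
  While (NLe (nsucc (nvar 4)) (nvar 6))
    (Seq (nset 6 (NSub (nvar 6) (NConst 1)))
    (Seq (RSet 2 (nvar 6)
            (mirror_x (RGet 0 (nvar 6)) (RGet 1 (nvar 6))
              (RGet 0 (nsucc (nvar 6))) (RGet 1 (nsucc (nvar 6)))
              (RGet 2 (nsucc (nvar 6))) (RGet 3 (nsucc (nvar 6)))))
         (RSet 3 (nvar 6)
            (mirror_y (RGet 0 (nvar 6)) (RGet 1 (nvar 6))
              (RGet 0 (nsucc (nvar 6))) (RGet 1 (nsucc (nvar 6)))
              (RGet 2 (nsucc (nvar 6))) (RGet 3 (nsucc (nvar 6))))))).

Definition walk_param : rexpr :=
  clamp_expr (crossing_expr (RGet 0 (nvar 6)) (RGet 1 (nvar 6))
        (RGet 0 (nsucc (nvar 6))) (RGet 1 (nsucc (nvar 6)))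
        (rvar 8) (rvar 9) (RGet 2 (nvar 6)) (RGet 3 (nvar 6))).

Definition walk_loop : cmd :=
  While (NLe (nsucc (nvar 6)) (nvar 5))
    (Seq (RSet 4 (nvar 6)
           walk_param)
    (Seq (rset 13 (edge_expr (RGet 0 (nvar 6)) (RGet 0 (nsucc (nvar 6))) (RGet 4 (nvar 6))))
    (Seq (rset 14 (edge_expr (RGet 1 (nvar 6)) (RGet 1 (nsucc (nvar 6))) (RGet 4 (nvar 6))))
    (Seq (rset 10 (RAdd (rvar 10) (dist_expr (rvar 8) (rvar 9) (rvar 13) (rvar 14))))
    (Seq (rset 8 (rvar 13))
    (Seq (rset 9 (rvar 14))
         (nset 6 (nsucc (nvar 6))))))))).

Definition piece_cmd : cmd :=
  Seq (Seq (Seq (nset 6 (NSub (nvar 5) (NConst 1)))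
                (RSet 2 (nvar 6) (RGet 0 (nvar 5))))
           (RSet 3 (nvar 6) (RGet 1 (nvar 5))))
  (Seq unfold_loop
  (Seq (Seq (Seq (rset 8 (RGet 0 (nvar 4))) (rset 9 (RGet 1 (nvar 4))))
            (rset 10 (RConst 0)))
  (Seq walk_loop
       (rset 10 (RAdd (rvar 10)
          (dist_expr (rvar 8) (rvar 9) (RGet 0 (nvar 5)) (RGet 1 (nvar 5)))))))).

(** * Computing one piece in linear time *)

Section Pieces.
Variable R : realType.
Implicit Types (s : state R).
Local Open Scope ring_scope.

Definition stores (p : nat -> R * R) (M : nat) s :=
  forall i, (i <= M)%N -> (rmem s 0 i, rmem s 1 i) = p i.

Definition walk p a b k : R :=
  \sum_(t < k) dist (piece_point p a b t) (piece_point p a b t.+1).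

Lemma walk_len (p : nat -> R * R) a b : (a < b)%N ->
  walk p a b (b - a) + dist (piece_point p a b (b - a)) (p b) = piece_len p a b.
Proof.
move=> ab; rewrite /piece_len /path_len.
have pE t : piece_point p a b t.+1 = pos p (piece p a b) (a + t).
  by rewrite -piece_pointS ?leq_addr // addKn.
have wE k : walk p a b k.+1 =
    dist (piece_point p a b 0) (pos p (piece p a b) a) + chain (pos p (piece p a b)) a (a + k).
  rewrite /walk; move: (piece_point p a b) pE => pp pE.
  elim: k => [|k IH]; first by rewrite addn0 chain_nil addr0 big_ord1 pE addn0.
  rewrite big_ord_recr /= IH !pE addnS.
  by rewrite (@chain_cat _ _ a (a + k) (a + k).+1) ?leq_addr // chain1 addrA.
have -> : (b - a = (b.-1 - a).+1)%N by lia.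
by rewrite wE pE subnKC //; lia.
Qed.

Lemma stores_frame p M P s s' : frame P s s' -> 0%N \notin rwrites P ->
  1%N \notin rwrites P -> stores p M s -> stores p M s'.
Proof. by move=> [_ fr] h0 h1 sp i iM; rewrite !fr // sp. Qed.

Lemma unfold_loop_spec : exists c, forall (p : nat -> R * R) n M a b s,
  (0 < n)%N -> (M <= 4 * n)%N -> stores p M s -> (a < b)%N -> (b <= M)%N ->
  nmem s 4 0 = a -> nmem s 6 0 = b.-1 -> (rmem s 2 b.-1, rmem s 3 b.-1) = p b ->
  runs unfold_loop s (c * (n * 1)) (fun s' => nmem s' 6 0 = a /\
    forall t, (t <= b.-1 - a)%N -> (rmem s' 2 (b.-1 - t), rmem s' 3 (b.-1 - t)) = unfold p b t).
Proof.
eexists => p n M a b s n0 M4 sp ab bM sa si sT.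
pose I k s' := nmem s' 6 0 = (b.-1 - k)%N /\
  forall t, (t <= k)%N -> (rmem s' 2 (b.-1 - t), rmem s' 3 (b.-1 - t)) = unfold p b t.
have m4 : (b.-1 - a <= 4 * n)%N by lia.
apply: runs_weaken (runs_whileO (I := I) m4 n0 (ltnSn 0) _ _ _) (leqnn _) _.
- by rewrite /I si subn0; split=> // t; rewrite leqn0 => /eqP ->; rewrite subn0.
- move=> k s' km F [Ii IT].
  have sp' : stores p M s' by apply: stores_frame F _ _ sp.
  have [fn _] := F; have sa' : nmem s' 4 0 = a by rewrite fn.
  split; first by rewrite /= sa' Ii; lia.
  have e0 : (b.-1 - k - 1 = b.-1 - k.+1)%N by lia.
  apply: runs_basicO => //; rewrite /I /= /update /= Ii e0.
  have e : (b.-1 - k.+1 + 1 = b.-1 - k)%N by lia.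
  split=> // t tk; rewrite e.
  have [->|tk'] := eqVneq t k.+1; last first.
    have -> : (b.-1 - t == b.-1 - k.+1)%N = false by lia.
    by apply: IT; lia.
  rewrite eqxx /=; have eb : (b.-1 - k.+1).+1 = (b.-1 - k)%N by lia.
  have h1 : (b.-1 - k.+1 <= M)%N by lia.
  have h2 : (b.-1 - k <= M)%N by lia.
  have -> : (b.-1 - k == b.-1 - k.+1)%N = false by lia.
  by rewrite eb -(sp' _ h1) -(sp' _ h2) -(IT k).
- by move=> s' [fn _] [Ii _]; rewrite /= Ii fn //= sa; lia.
- move=> s' [F [Ii IT]]; split; first by rewrite Ii; lia.
  exact: IT.
Qed.

Lemma walk_loop_spec : exists c, forall (p : nat -> R * R) n M a b s,
  (0 < n)%N -> (M <= 4 * n)%N -> stores p M s -> (a < b)%N -> (b <= M)%N ->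
  nmem s 5 0 = b -> nmem s 6 0 = a -> (rmem s 8 0, rmem s 9 0) = p a -> rmem s 10 0 = 0 ->
  (forall t, (t <= b.-1 - a)%N -> (rmem s 2 (b.-1 - t), rmem s 3 (b.-1 - t)) = unfold p b t) ->
  runs walk_loop s (c * (n * 1)) (fun s' =>
    [/\ (rmem s' 8 0, rmem s' 9 0) = piece_point p a b (b - a),
        rmem s' 10 0 = walk p a b (b - a) &
    forall i, rmem s' 4 i = if (a <= i < b)%N then piece p a b i else rmem s 4 i]).
Proof.
eexists => p n M a b s n0 M4 sp ab bM sb si sc sl sT.
pose I k s' := [/\ nmem s' 6 0 = (a + k)%N,
  (rmem s' 8 0, rmem s' 9 0) = piece_point p a b k, rmem s' 10 0 = walk p a b k &
  forall i, rmem s' 4 i = if (a <= i < a + k)%N then piece p a b i else rmem s 4 i].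
have m4 : (b - a <= 4 * n)%N by lia.
apply: runs_weaken (runs_whileO (I := I) m4 n0 (ltnSn 0) _ _ _) (leqnn _) _.
- rewrite /I si addn0; split=> //; first by rewrite sl /walk big_ord0.
  by move=> i; have -> : (a <= i < a)%N = false by lia.
- move=> k s' km F [Ii Ic Il IS].
  have sp' : stores p M s' by apply: stores_frame F _ _ sp.
  have [fn fr] := F; have sb' : nmem s' 5 0 = b by rewrite fn.
  split; first by rewrite /= sb' Ii; lia.
  apply: runs_basicO => //.
  have cl : reval s' walk_param = piece p a b (a + k).
    rewrite /walk_param reval_clamp reval_crossing /piece /= Ii Ic addn1 !sp' ?addKn; [|lia ..].
    rewrite (fr 2%N) // (fr 3%N) //.
    by have := sT (b.-1 - (a + k))%N; rewrite subKn => [->|]//; lia.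
  have s1E : run (RSet 4 (nvar 6) walk_param) s' =
      State (nmem s') (update (rmem s') 4 (a + k)%N (piece p a b (a + k))).
    by rewrite /run cl /= Ii.
  rewrite run_seq s1E => {s1E}.
  have [s1 s1E] : exists s1,
      s1 = State (nmem s') (update (rmem s') 4 (a + k)%N (piece p a b (a + k))).
    by eexists.
  rewrite -s1E.
  have S1 i : rmem s1 4 i = if i == (a + k)%N then piece p a b i else rmem s' 4 i.
    by rewrite s1E /= /update /=; case: eqP => // ->.
  have [sp1 [i1 [c1 c1' l1]]] : stores p M s1 /\ nmem s1 6 0 = (a + k)%N /\
      [/\ rmem s1 8 0 = rmem s' 8 0, rmem s1 9 0 = rmem s' 9 0 & rmem s1 10 0 = rmem s' 10 0].
    by rewrite s1E.
  have akM : (a + k < M)%N by lia.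
  have [x1 x2] := (sp1 _ (ltnW akM), sp1 _ akM).
  have pE : pos p (piece p a b) (a + k) = piece_point p a b k.+1.
    by rewrite -piece_pointS ?leq_addr // addKn.
  have ptE : (reval s1 (edge_expr (RGet 0 (nvar 6)) (RGet 0 (nsucc (nvar 6))) (RGet 4 (nvar 6))),
      reval s1 (edge_expr (RGet 1 (nvar 6)) (RGet 1 (nsucc (nvar 6))) (RGet 4 (nvar 6)))) =
      piece_point p a b k.+1.
    by rewrite -pE /= i1 S1 eqxx addn1 /pos -x1 -x2.
  clear cl s1E; move: S1 i1 c1 c1' l1 ptE; rewrite /I /= /update /=.
  move=> S1 i1 c1 c1' l1 ptE; split.
  - by rewrite i1 addn1 addnS.
  - exact: ptE.
  - have -> : walk p a b k.+1 =
        walk p a b k + dist (piece_point p a b k) (piece_point p a b k.+1).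
      by rewrite /walk big_ord_recr.
    by rewrite [piece_point _ _ _ k.+1]/= -ptE -Ic -Il -c1 -c1' -l1 /dist /= !expr2.
  - move=> i; rewrite S1; case: eqP => [->|/eqP ik].
      by rewrite leq_addr addnS ltnSn.
    rewrite IS addnS ltnS.
    by have -> : (a <= i <= a + k)%N = (a <= i < a + k)%N by lia.
- by move=> s' [fn _] [Ii _ _ _]; rewrite /= Ii fn //= sb; lia.
- move=> s' [F [Ii Ic Il IS]]; split=> // i.
  by rewrite IS subnKC // ltnW.
Qed.

Lemma piece_cmd_spec : exists c, forall (p : nat -> R * R) n M a b s,
  (0 < n)%N -> (M <= 4 * n)%N -> stores p M s -> (a < b)%N -> (b <= M)%N ->
  nmem s 4 0 = a -> nmem s 5 0 = b ->
  runs piece_cmd s (c * (n * 1)) (fun s' => rmem s' 10 0 = piece_len p a b /\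
    forall i, rmem s' 4 i = if (a <= i < b)%N then piece p a b i else rmem s 4 i).
Proof.
have [cu unfold_ok] := unfold_loop_spec; have [cw walk_ok] := walk_loop_spec.
eexists => p n M a b s n0 M4 sp ab bM sa sb.
have x0 : (0 < n * 1)%N by rewrite muln1.
apply: runs_seqO; apply: runs_basicO => //.
set s1 := run _ s.
have [sp1 [sa1 sb1] si1] : [/\ stores p M s1, nmem s1 4 0 = a /\ nmem s1 5 0 = b &
    nmem s1 6 0 = b.-1] by rewrite /s1 /= /update /= sb subn1.
have S1 : rmem s1 4 = rmem s 4 by [].
have T1 : (rmem s1 2 b.-1, rmem s1 3 b.-1) = p b.
  by rewrite /s1 /= /update /= sb subn1 eqxx /= sp.
move: s1 sp1 sa1 sb1 si1 S1 T1 => s1 sp1 sa1 sb1 si1 S1 T1.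
apply: runs_seqO.
apply: runs_weaken (runs_frame (unfold_ok p n M a b s1 n0 M4 sp1 ab bM sa1 si1 T1)) (leqnn _) _.
move=> s2 [F2 [i2 T2]].
have [fn2 fr2] := F2.
apply: runs_seqO; apply: runs_basicO => //; set s3 := run _ s2.
have sp3 : stores p M s3 by apply: (stores_frame F2 _ _ sp1).
have sb3 : nmem s3 5 0 = b by rewrite /s3 /= fn2.
have c3 : (rmem s3 8 0, rmem s3 9 0) = p a.
  rewrite /s3 /= /update /= fn2 // sa1 -(sp1 a) ?fr2 //; lia.
have S3 : rmem s3 4 = rmem s2 4 by [].
move: s3 sp3 sb3 c3 (erefl : rmem s3 10 0 = 0) (i2 : nmem s3 6 0 = a)
  (T2 : forall t, (t <= b.-1 - a)%N -> (rmem s3 2 (b.-1 - t), rmem s3 3 (b.-1 - t)) = unfold p b t)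
  S3 => s3 sp3 sb3 c3 l3 i3 T3 S3.
apply: runs_seqO.
apply: runs_weaken (runs_frame (walk_ok p n M a b s3 n0 M4 sp3 ab bM sb3 i3 c3 l3 T3)) (leqnn _) _.
move=> s4 [F4 [c4 l4 S4]]; have [fn4 fr4] := F4.
apply: runs_basicO => //; rewrite /= /update /=; split; last first.
  by move=> i; rewrite S4 S3 fr2 // S1.
rewrite -walk_len // l4 fn4 // sb3 -c4 (fr4 0%N) // (fr4 1%N) // -(sp3 b) //.
Qed.

End Pieces.

(** Cells [n] to [4n] are filled, each from the cell [n] places before it; index [4n] itself is the
    end of a path starting at [j = 2n]. *)
Definition extend_cmd : cmd :=
  Seq (Seq (nset 1 (NAdd (nvar 0) (nvar 0)))
      (Seq (nset 2 (NAdd (nvar 1) (nvar 1))) (nset 11 (NConst 0))))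
  (While (NLe (nvar 11) (NAdd (nvar 1) (nvar 0)))
    (Seq (RSet 0 (NAdd (nvar 11) (nvar 0)) (RGet 0 (nvar 11)))
    (Seq (RSet 1 (NAdd (nvar 11) (nvar 0)) (RGet 1 (nvar 11)))
         (nset 11 (nsucc (nvar 11)))))).

(** The table of pairs lives in a one-dimensional array, and indices cannot be multiplied; the row
    offsets are therefore built by repeated addition. *)
Definition rows_cmd : cmd :=
  Seq (Seq (NSet 3 (NConst 0) (NConst 0)) (nset 11 (NConst 0)))
  (While (NLe (nsucc (nvar 11)) (nvar 2))
    (Seq (NSet 3 (nsucc (nvar 11)) (NAdd (NGet 3 (nvar 11)) (nsucc (nvar 2))))
         (nset 11 (nsucc (nvar 11))))).

Definition table_row_cmd : cmd :=
  Seq (nset 5 (nsucc (nvar 4)))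
  (While (NLe (nvar 5) (nvar 2))
    (Seq piece_cmd
    (Seq (RSet 5 (NAdd (NGet 3 (nvar 4)) (nvar 5)) (rvar 10))
         (nset 5 (nsucc (nvar 5)))))).

Definition table_cmd : cmd :=
  Seq (nset 4 (NConst 0))
  (While (NLe (nsucc (nvar 4)) (nvar 2))
    (Seq table_row_cmd (nset 4 (nsucc (nvar 4))))).

(** * The table of piece lengths *)

Section Table.
Variable R : realType.
Implicit Types (s : state R) (p : nat -> R * R).
Local Open Scope ring_scope.

Definition env p n s := stores p (4 * n) s /\
  [/\ nmem s 0 0 = n, nmem s 1 0 = (2 * n)%N & nmem s 2 0 = (4 * n)%N].

Lemma env_frame p n P s s' : frame P s s' -> all (fun a => a \notin nwrites P) [:: 0; 1; 2]%N ->
  all (fun a => a \notin rwrites P) [:: 0; 1]%N -> env p n s -> env p n s'.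
Proof.
move=> F /= /and4P[h0 h1 h2 _] /and3P[r0 r1 _] [sp [e0 e1 e2]]; split.
  exact: stores_frame F r0 r1 sp.
by have [fn _] := F; rewrite !fn.
Qed.

Lemma extend_cmd_spec : exists c, forall C, (0 < size C)%N ->
  runs extend_cmd (input C) (c * (size C * 1)) (env (vertex C) (size C)).
Proof.
eexists => C n0; set n := size C in n0 *; set p := vertex C.
have x0 : (0 < n * 1)%N by rewrite muln1.
apply: runs_seqO; apply: runs_basicO => //; set s1 := run _ _.
have [e0 e1 e2 e11] : [/\ nmem s1 0 0 = n, nmem s1 1 0 = (2 * n)%N, nmem s1 2 0 = (4 * n)%N &
    nmem s1 11 0 = 0%N].
  by rewrite /s1 /= /update /= -/n; split=> //; lia.
have r1 i : (i < n)%N -> (rmem s1 0 i, rmem s1 1 i) = p i.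
  by move=> ilt; rewrite /s1 /= /p /vertex modn_small // -surjective_pairing.
clearbody s1.
pose I k s := [/\ nmem s 11 0 = k & forall i, (i < k + n)%N -> (rmem s 0 i, rmem s 1 i) = p i].
have m4 : ((3 * n).+1 <= 4 * n)%N by lia.
apply: runs_weaken (runs_whileO (I := I) m4 n0 (ltnSn 0) _ _ _) (leqnn _) _.
- by [].
- move=> k s' km [fn _] [Ik Ir].
  have f0 : nmem s' 0 0 = n by rewrite fn.
  have f1 : nmem s' 1 0 = (2 * n)%N by rewrite fn.
  split; first by rewrite /= Ik f0 f1; lia.
  apply: runs_basicO => //; rewrite /I /= /update /= Ik f0 addn1; split=> // i hi.
  have [->|ne] := eqVneq i (k + n)%N; last by apply: Ir; lia.
  rewrite Ir; last by lia.
  by rewrite /p vertex_periodic.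
- by move=> s' [fn _] [Ik _]; rewrite /= Ik !fn //= e0 e1; lia.
move=> s' [[fn _] [Ik Ir]]; split; last by rewrite !fn.
by move=> i hi; apply: Ir; lia.
Qed.

Definition rows n s := forall a, (a <= 4 * n)%N -> nmem s 3 a = (a * (4 * n).+1)%N.

Lemma rows_cmd_spec : exists c, forall p n s, (0 < n)%N -> env p n s ->
  runs rows_cmd s (c * (n * 1)) (rows n).
Proof.
eexists => p n s n0 es.
have x0 : (0 < n * 1)%N by rewrite muln1.
apply: runs_seqO; apply: runs_basicO => //; set s1 := run _ _.
have [_ [_ _ e2]] : env p n s1 by [].
have e11 : nmem s1 11 0 = 0%N by [].
have e3 : nmem s1 3 0 = 0%N by [].
clearbody s1.
pose I k s := [/\ nmem s 11 0 = k & forall a, (a <= k)%N -> nmem s 3 a = (a * (4 * n).+1)%N].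
apply: runs_weaken (runs_whileO (I := I) (leqnn (4 * n)) n0 (ltnSn 0) _ _ _) (leqnn _) _.
- by split=> // a; rewrite leqn0 => /eqP ->; rewrite e3.
- move=> k s' km [fn _] [Ik Ir].
  have f2 : nmem s' 2 0 = (4 * n)%N by rewrite fn.
  split; first by rewrite /= Ik f2; lia.
  apply: runs_basicO => //; rewrite /I /= /update /= Ik f2 !addn1; split=> // a hi.
  have [->|ne] := eqVneq a k.+1; last by apply: Ir; lia.
  by rewrite Ir // mulSn addnC.
- by move=> s' [fn _] [Ik _]; rewrite /= Ik !fn //= e2; lia.
by move=> s' [_ [_ Ir]].
Qed.

Definition table p n s := rows n s /\ forall a b, (a < b)%N -> (b <= 4 * n)%N ->
  rmem s 5 (a * (4 * n).+1 + b)%N = piece_len p a b.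

Lemma row_index_inj (m a b a' b' : nat) : (b < m)%N -> (b' < m)%N ->
  (a * m + b = a' * m + b')%N -> a = a' /\ b = b'.
Proof.
move=> bm bm' e; have h : b = b'.
  by rewrite -(modn_small bm) -(modn_small bm') -(modnMDl a) e modnMDl.
split=> //; move: e; rewrite h => /addIn /eqP; rewrite eqn_mul2r.
by case/orP => /eqP //; lia.
Qed.

Lemma table_row_cmd_spec : exists c, forall p n s a, (0 < n)%N -> env p n s -> rows n s ->
  nmem s 4 0 = a -> (a < 4 * n)%N ->
  runs table_row_cmd s (c * (n * (n * 1))) (fun s' => forall i,
    (forall b, (a < b)%N -> (b <= 4 * n)%N -> i = (a * (4 * n).+1 + b)%N ->
       rmem s' 5 i = piece_len p a b) /\
    ((forall b, (a < b)%N -> (b <= 4 * n)%N -> i <> (a * (4 * n).+1 + b)%N) ->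
       rmem s' 5 i = rmem s 5 i)).
Proof.
have [cp piece_ok] := @piece_cmd_spec R.
eexists => p n s a n0 es rs sa an.
have x1 : (0 < n * 1)%N by rewrite muln1.
have x0 : (0 < n * (n * 1))%N by rewrite muln_gt0 n0.
apply: runs_seqO; apply: runs_basicO => //; set s1 := run _ _.
have es1 : env p n s1 by [].
have rs1 : rows n s1 by [].
have e5 : nmem s1 5 0 = a.+1 by rewrite /s1 /= /update /= sa addn1.
have s1r : rmem s1 5 = rmem s 5 by [].
have e4 : nmem s1 4 0 = a by [].
clearbody s1.
pose I k s := [/\ nmem s 5 0 = (a + k).+1 & forall i,
    (forall b, (a < b)%N -> (b <= a + k)%N -> i = (a * (4 * n).+1 + b)%N ->
       rmem s 5 i = piece_len p a b) /\
    ((forall b, (a < b)%N -> (b <= a + k)%N -> i <> (a * (4 * n).+1 + b)%N) ->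
       rmem s 5 i = rmem s1 5 i)].
have m4 : (4 * n - a <= 4 * n)%N by exact: leq_subr.
apply: runs_weaken (runs_whileO (I := I) m4 n0 x1 _ _ _) (leqnn _) _.
- rewrite /I e5 addn0; split=> // i; split=> // b; lia.
- move=> k s' km F [Ik Ir]; have [fn _] := F.
  have es' : env p n s' by apply: env_frame F _ _ es1.
  have rs' : rows n s' by rewrite /rows fn.
  have f4 : nmem s' 4 0 = a by rewrite fn.
  have [sp' [_ _ f2]] := es'.
  split; first by rewrite /= Ik f2; lia.
  have h1 : (a < (a + k).+1)%N by lia.
  have h2 : ((a + k).+1 <= 4 * n)%N by lia.
  apply: runs_seqO.
  apply: runs_weaken (runs_frame (piece_ok p n _ _ _ s' n0 (leqnn _) sp' h1 h2 f4 Ik)) (leqnn _) _.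
  move=> s2 [[fn2 fr2] [l2 _]]; apply: runs_basicO => //.
  rewrite /I /= /update /= !fn2 // Ik f4 addn1 addnS rs'; last by lia.
  split=> // i; rewrite l2 fr2 //; have [Ir1 Ir2] := Ir i; split.
    move=> b ab bk ei; have [eb|ne] := eqVneq b (a + k).+1.
      by rewrite ei eb eqxx.
    have -> : (i == a * (4 * n).+1 + (a + k).+1)%N = false.
      by apply/eqP; rewrite ei => /addnI; apply/eqP.
    by apply: Ir1 ei => //; lia.
  move=> hi; have -> : (i == a * (4 * n).+1 + (a + k).+1)%N = false.
    by apply/eqP; apply: hi; lia.
  by apply: Ir2 => b ab bk; apply: hi => //; lia.
- move=> s' [fn _] [Ik _]; rewrite /= Ik fn //; have [_ [_ _ ->]] := es1; lia.
move=> s' [_ [_ Ir]] i; have [Ir1 Ir2] := Ir i; rewrite subnKC ?(ltnW an) // in Ir1 Ir2.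
by split=> // h; rewrite -s1r; apply: Ir2.
Qed.

Lemma table_cmd_spec : exists c, forall p n s, (0 < n)%N -> env p n s -> rows n s ->
  runs table_cmd s (c * (n * (n * (n * 1)))) (table p n).
Proof.
have [cr row_ok] := table_row_cmd_spec.
eexists => p n s n0 es rs.
have x1 : (0 < n * (n * 1))%N by rewrite !muln_gt0 n0.
have x0 : (0 < n * (n * (n * 1)))%N by rewrite !muln_gt0 n0.
apply: runs_seqO; apply: runs_basicO => //; set s1 := run _ _.
have es1 : env p n s1 by [].
have rs1 : rows n s1 by [].
have e4 : nmem s1 4 0 = 0%N by [].
clearbody s1.
pose I k s := [/\ nmem s 4 0 = k & forall a b, (a < k)%N -> (a < b)%N -> (b <= 4 * n)%N ->
  rmem s 5 (a * (4 * n).+1 + b)%N = piece_len p a b].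
apply: runs_weaken (runs_whileO (I := I) (leqnn (4 * n)) n0 x1 _ _ _) (leqnn _) _.
- by [].
- move=> k s' km F [Ik Ir]; have [fn _] := F.
  have es' : env p n s' by apply: env_frame F _ _ es1.
  have rs' : rows n s' by rewrite /rows fn.
  have [sp' [_ _ f2]] := es'.
  split; first by rewrite /= Ik f2; lia.
  apply: runs_seqO.
  apply: runs_weaken (runs_frame (row_ok p n s' k n0 es' rs' Ik km)) (leqnn _) _.
  move=> s2 [[fn2 fr2] Ir2]; apply: runs_basicO => //.
  rewrite /I /= /update /= !fn2 // Ik addn1; split=> // a b ak ab bn.
  have [h1 h2] := Ir2 (a * (4 * n).+1 + b)%N.
  have [e|ne] := eqVneq a k; first by rewrite [in RHS]e; apply: h1; rewrite -?e.
  rewrite h2; first by apply: Ir => //; lia.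
  move=> b' kb' bn' /row_index_inj[] //; by move: ne => /eqP.
- by move=> s' [fn _] [Ik _]; rewrite /= Ik !fn //=; have [_ [_ _ ->]] := es1; lia.
move=> s' [[fn _] [_ Ir]]; split; first by rewrite /rows fn.
by move=> a b ab bn; apply: Ir => //; lia.
Qed.

End Table.

(** Indices of the dynamic program are relative to the start [j]: this is the cost of reaching
    [p (j + k)] by a last piece from [p (j + l)], with [k] in index variable 8. *)
Definition entry (l : nexpr) : rexpr :=
  RAdd (RGet 6 l) (RGet 5 (NAdd (NGet 3 (NAdd (nvar 7) l)) (NAdd (nvar 7) (nvar 8)))).

Definition dp_step_cmd : cmd :=
  Seq (Seq (RSet 6 (nvar 8) (entry (NConst 0)))
      (Seq (NSet 10 (nvar 8) (NConst 0)) (nset 9 (NConst 1))))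
  (While (NLe (nsucc (nvar 9)) (nvar 8))
    (Seq (If (RLe (RGet 6 (nvar 8)) (entry (nvar 9))) Skip
           (Seq (RSet 6 (nvar 8) (entry (nvar 9))) (NSet 10 (nvar 8) (nvar 9))))
         (nset 9 (nsucc (nvar 9))))).

Definition dp_cmd : cmd :=
  Seq (Seq (RSet 6 (NConst 0) (RConst 0)) (nset 8 (NConst 1)))
  (While (NLe (nvar 8) (nvar 1))
    (Seq dp_step_cmd (nset 8 (nsucc (nvar 8))))).

(** Follows the predecessors back from [2n]; each piece is recomputed for its side effect on the
    parameters in array 4. At most [2n] pieces of linear cost fit in O(n^2). *)
Definition trace_cmd : cmd :=
  Seq (nset 8 (nvar 1))
  (While (NLe (NConst 1) (nvar 8))
    (Seq (Seq (nset 9 (NGet 10 (nvar 8)))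
         (Seq (nset 4 (NAdd (nvar 7) (nvar 9))) (nset 5 (NAdd (nvar 7) (nvar 8)))))
    (Seq piece_cmd (nset 8 (nvar 9))))).

(** The traced path occupies indices [j] to [j + 2n - 1]; moving those from [2n] on down by [2n]
    leaves one period starting at 0. *)
Definition fold_cmd : cmd :=
  Seq (nset 11 (NConst 0))
  (While (NLe (nsucc (nvar 11)) (nvar 7))
    (Seq (RSet 4 (nvar 11) (RGet 4 (NAdd (nvar 11) (nvar 1)))) (nset 11 (nsucc (nvar 11))))).

Definition average_cmd : cmd :=
  Seq (nset 11 (NConst 0))
  (While (NLe (nsucc (nvar 11)) (nvar 0))
    (Seq (RSet 7 (nvar 11)
           (RDiv (RAdd (RGet 4 (nvar 11)) (RGet 4 (NAdd (nvar 11) (nvar 0)))) (RConst 2)))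
         (nset 11 (nsucc (nvar 11))))).

Definition improve_cmd : cmd :=
  Seq (rset 11 (RGet 6 (nvar 1))) (Seq trace_cmd (Seq fold_cmd average_cmd)).

(** The condition says [j = 0] or no worse than the stored bound: at the first start nothing has
    been stored yet. *)
Definition search_cmd : cmd :=
  Seq (nset 7 (NConst 0))
  (While (NLe (nvar 7) (nvar 1))
    (Seq dp_cmd
    (Seq (If (BNot (BAnd (BNot (NLe (nvar 7) (NConst 0)))
                         (BNot (RLe (RGet 6 (nvar 1)) (rvar 11)))))
             improve_cmd Skip)
         (nset 7 (nsucc (nvar 7)))))).

(** * The dynamic program for one start *)

Section DynamicProgram.
Variable R : realType.
Implicit Types (s : state R) (p : nat -> R * R).
Local Open Scope ring_scope.

(** Bellman's equation, split into attainment, which [trace_cmd] uses, and minimality, which makes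
    [W] a potential for [shortest_path]. *)
Definition dp_entry p j (W : nat -> R) (pred : nat -> nat) k :=
  [/\ (pred k < k)%N, W k = W (pred k) + piece_len p (j + pred k) (j + k) &
      forall l, (l < k)%N -> W k <= W l + piece_len p (j + l) (j + k)].

Lemma dp_step_spec : exists c, forall p n s j k, (0 < n)%N -> env p n s -> table p n s ->
  nmem s 7 0 = j -> nmem s 8 0 = k -> (0 < k)%N -> (k <= 2 * n)%N -> (j <= 2 * n)%N ->
  runs dp_step_cmd s (c * (n * 1)) (fun s' =>
    dp_entry p j (rmem s' 6) (nmem s' 10) k /\
    forall t, t != k -> rmem s' 6 t = rmem s 6 t /\ nmem s' 10 t = nmem s 10 t).
Proof.
eexists => p n s j k n0 es ts sj sk k0 kn jn.
have x0 : (0 < n * 1)%N by rewrite muln1.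
have bound l : (l < k)%N -> (j + l <= 4 * n)%N by lia.
have val s' l : table p n s' -> nmem s' 7 0 = j -> nmem s' 8 0 = k -> (l < k)%N ->
    rmem s' 5 (nmem s' 3 (j + l) + (j + k))%N = piece_len p (j + l) (j + k).
  by move=> [rs' ts'] _ _ lk; rewrite rs' ?ts' //; lia.
apply: runs_seqO; apply: runs_basicO => //; set s1 := run _ _.
have ts1 : table p n s1.
  have [rs ts'] := ts; split; last exact: ts'.
  by move=> a ha; rewrite /s1 /= /update /= rs.
have j1 : nmem s1 7 0 = j by [].
have k1 : nmem s1 8 0 = k by [].
have l1 : nmem s1 9 0 = 1%N by [].
have P1 t : nmem s1 10 t = if t == k then 0%N else nmem s 10 t.
  by rewrite /s1 /= /update /= sk.
have W1 t : rmem s1 6 t = if t == k then rmem s 6 0 + piece_len p (j + 0) (j + k) else rmem s 6 t.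
  by rewrite /s1 /= /update /= sk sj val.
clearbody s1.
pose I i s' := [/\ nmem s' 9 0 = i.+1,
   forall t, t != k -> rmem s' 6 t = rmem s 6 t /\ nmem s' 10 t = nmem s 10 t,
   (nmem s' 10 k < k)%N,
   rmem s' 6 k = rmem s 6 (nmem s' 10 k) + piece_len p (j + nmem s' 10 k) (j + k) &
   forall l, (l <= i)%N -> rmem s' 6 k <= rmem s 6 l + piece_len p (j + l) (j + k)].
have m4 : (k.-1 <= 2 * n)%N by lia.
apply: runs_weaken (runs_whileO (I := I) m4 n0 (ltnSn 0) _ _ _) (leqnn _) _.
- rewrite /I l1 P1 W1 eqxx; split=> // [t /negPf tk|l].
    by rewrite P1 W1 tk.
  by rewrite leqn0 => /eqP ->.
- move=> i s' ik F [Il Iold Ip Iw Imin]; have [fn fr] := F.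
  have j' : nmem s' 7 0 = j by rewrite fn.
  have k' : nmem s' 8 0 = k by rewrite fn.
  have ts' : table p n s'.
    have [rs1 t1] := ts1; split; first by rewrite /rows fn.
    by move=> a b ab bn; rewrite fr // t1.
  have ilt : (i.+1 < k)%N by lia.
  split; first by rewrite /= Il k' addn1.
  apply: runs_basicO => //.
  have eE : reval s' (entry (nvar 9)) = rmem s 6 i.+1 + piece_len p (j + i.+1) (j + k).
    rewrite /= Il j' k' val // (Iold i.+1 _).1 //.
    by rewrite neq_ltn ilt.
  rewrite run_seq; set b := RLe _ _.
  have bE : beval s' b = (rmem s' 6 k <= rmem s 6 i.+1 + piece_len p (j + i.+1) (j + k)).
    by rewrite /b /beval eE /= k'.
  rewrite [run (If _ _ _) _](_ : _ = if beval s' b then s' else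
    run (Seq (RSet 6 (nvar 8) (entry (nvar 9))) (NSet 10 (nvar 8) (nvar 9))) s') // bE.
  case: ifPn => hb.
    rewrite /I /= /update /= Il addn1; split=> // l.
    by rewrite leq_eqVlt ltnS => /predU1P[->|/Imin].
  have -> : run (Seq (RSet 6 (nvar 8) (entry (nvar 9))) (NSet 10 (nvar 8) (nvar 9))) s' =
      State (update (nmem s') 10 k i.+1)
        (update (rmem s') 6 k (rmem s 6 i.+1 + piece_len p (j + i.+1) (j + k))).
    by rewrite /run eE /= k' Il.
  rewrite /I /= /update /= Il eqxx addn1.
  split=> // [t /negPf tk|l].
    by rewrite tk; apply: Iold; rewrite tk.
  rewrite -ltNge in hb.
  rewrite leq_eqVlt ltnS => /predU1P[->//|/Imin] h.
  exact: le_trans (ltW hb) h.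
- by move=> s' [fn _] [Il _ _ _ _]; rewrite /= Il fn // k1; lia.
move=> s' [_ [_ Iold Ip Iw Imin]]; split=> //; split=> //.
  by rewrite Iw (Iold (nmem s' 10 k) _).1 // neq_ltn Ip.
move=> l lk; rewrite (Iold l _).1; last by rewrite neq_ltn lk.
by apply: Imin; lia.
Qed.

Lemma dp_cmd_spec : exists c, forall p n s j, (0 < n)%N -> env p n s -> table p n s ->
  nmem s 7 0 = j -> (j <= 2 * n)%N ->
  runs dp_cmd s (c * (n * (n * 1))) (fun s' => rmem s' 6 0 = 0 /\
    forall k, (0 < k)%N -> (k <= 2 * n)%N -> dp_entry p j (rmem s' 6) (nmem s' 10) k).
Proof.
have [cd step_ok] := dp_step_spec.
eexists => p n s j n0 es ts sj jn.
have x1 : (0 < n * 1)%N by rewrite muln1.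
have x0 : (0 < n * (n * 1))%N by rewrite muln_gt0 n0.
apply: runs_seqO; apply: runs_basicO => //; set s1 := run _ _.
have ts1 : table p n s1 by [].
have es1 : env p n s1 by [].
have j1 : nmem s1 7 0 = j by [].
have k1 : nmem s1 8 0 = 1%N by [].
have w1 : rmem s1 6 0 = 0 by [].
clearbody s1.
pose I i s' := [/\ nmem s' 8 0 = i.+1, rmem s' 6 0 = 0 &
   forall k, (0 < k)%N -> (k <= i)%N -> dp_entry p j (rmem s' 6) (nmem s' 10) k].
apply: runs_weaken (runs_whileO (I := I) (leqnn (2 * n)) n0 x1 _ _ _) (leqnn _) _.
- by split=> // k k0 k00; move: k0; rewrite ltnNge k00.
- move=> i s' ik F [Ik Iw Id]; have [fn fr] := F.
  have j' : nmem s' 7 0 = j by rewrite fn.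
  have es' : env p n s' by apply: env_frame F _ _ es1.
  have ts' : table p n s'.
    have [rs1 t1] := ts1; split; first by rewrite /rows fn.
    by move=> a b ab bn; rewrite fr // t1.
  split; first by rewrite /= Ik; have [_ [_ -> _]] := es'.
  apply: runs_seqO.
  have hrun := step_ok p n s' j i.+1 n0 es' ts' j' Ik (ltn0Sn i) ik jn.
  apply: runs_weaken (runs_frame hrun) (leqnn _) _.
  move=> s2 [[fn2 _] [e2 old2]]; apply: runs_basicO => //.
  have i2 : nmem s2 8 0 = i.+1 by rewrite fn2.
  split; first by rewrite /= /update /= i2 addn1.
    by rewrite /= (old2 0%N _).1.
  move=> k k0; rewrite leq_eqVlt => /predU1P[->|ki]; first exact: e2.
  have [h1 h2 h3] := Id k k0 ki.
  have ne t : (t <= i)%N -> t != i.+1 by move=> h; rewrite neq_ltn ltnS h.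
  have pE : nmem s2 10 k = nmem s' 10 k by rewrite (old2 k (ne _ ki)).2.
  have wE t : (t <= i)%N -> rmem s2 6 t = rmem s' 6 t by move=> h; rewrite (old2 t (ne _ h)).1.
  have pi : (nmem s' 10 k <= i)%N by rewrite (leq_trans (ltnW h1)).
  split=> [||l lk]; rewrite /= /update /= ?pE ?wE ?h3 //.
  by rewrite (leq_trans (ltnW lk)).
- by move=> s' [fn _] [Ik _ _]; rewrite /= Ik fn //; have [_ [_ -> _]] := es1; rewrite ltnn.
by move=> s' [_ [_ ? ?]].
Qed.

End DynamicProgram.

(** * Recovering, folding and averaging a path *)

Section Reconstruction.
Variable R : realType.
Implicit Types (s : state R) (p : nat -> R * R).
Local Open Scope ring_scope.

Lemma trace_cmd_spec : exists c, forall p n s j, (0 < n)%N -> env p n s ->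
  nmem s 7 0 = j -> (j <= 2 * n)%N -> rmem s 6 0 = 0 ->
  (forall k, (0 < k)%N -> (k <= 2 * n)%N -> dp_entry p j (rmem s 6) (nmem s 10) k) ->
  runs trace_cmd s (c * (n * (n * 1))) (fun s' =>
    (forall t, (j <= t < j + 2 * n)%N -> 0 <= rmem s' 4 t <= 1) /\
    path_len p j (j + 2 * n) (rmem s' 4) <= rmem s 6 (2 * n)%N).
Proof.
have [cp piece_ok] := @piece_cmd_spec R.
eexists => p n s j n0 es sj jn w0 dps.
have x1 : (0 < n * 1)%N by rewrite muln1.
have x0 : (0 < n * (n * 1))%N by rewrite muln_gt0 n0.
apply: runs_seqO; apply: runs_basicO => //; set s1 := run _ _.
have es1 : env p n s1 by [].
have j1 : nmem s1 7 0 = j by [].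
have k1 : nmem s1 8 0 = (2 * n)%N by rewrite /s1 /= /update /=; have [_ [_ -> _]] := es.
have w1 : rmem s1 6 = rmem s 6 by [].
have P1 : nmem s1 10 = nmem s 10 by [].
clearbody s1.
set N := (2 * n)%N in jn k1 dps *.
(* The part already traced, from [p (j + k)] to the end, costs at most [W N - W k]. The estimate is
   guarded by [k < N], since [path_len] describes no path before the first piece is laid. *)
pose I s' := [/\ (nmem s' 8 0 <= N)%N,
  (forall t, (j + nmem s' 8 0 <= t < j + N)%N -> 0 <= rmem s' 4 t <= 1) &
  (nmem s' 8 0 < N)%N ->
    path_len p (j + nmem s' 8 0) (j + N) (rmem s' 4) <= rmem s 6 N - rmem s 6 (nmem s' 8 0)].
pose mu s' := nmem s' 8 0.
apply: runs_weaken (runs_while_measureO (I := I) (mu := mu) (leqnn N) n0 x1 _ _ _) (leqnn _) _.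
- by rewrite /mu k1.
- by rewrite /I k1; split=> // [t|]; [lia | rewrite ltnn].
- move=> s' F [kN Iu IL]; have [fn fr] := F.
  have [k ek] : exists k, nmem s' 8 0 = k by eexists.
  rewrite /mu.
  rewrite ek in kN Iu IL *.
  rewrite /= ek => k0; have [pk Wk Wmin] := dps k k0 kN.
  have j' : nmem s' 7 0 = j by rewrite fn.
  have P' : nmem s' 10 = nmem s 10 by rewrite fn.
  apply: runs_seqO; apply: runs_basicO => //; set s2 := run _ _.
  have es2 : env p n s2 by have : env p n s' by apply: env_frame F _ _ es1.
  have [l2 a2 b2] : [/\ nmem s2 9 0 = nmem s 10 k, nmem s2 4 0 = (j + nmem s 10 k)%N &
      nmem s2 5 0 = (j + k)%N].
    by rewrite /s2 /= /update /= ek j' P'.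
  have S2 : rmem s2 4 = rmem s' 4 by [].
  clearbody s2; set l := nmem s 10 k in pk Wk l2 a2 b2.
  have h1 : (j + l < j + k)%N by rewrite ltn_add2l.
  have h2 : (j + k <= 4 * n)%N by rewrite /N in jn kN; lia.
  apply: runs_seqO.
  have hrun := piece_ok p n _ _ _ s2 n0 (leqnn _) es2.1 h1 h2 a2 b2.
  apply: runs_weaken (runs_frame hrun) (leqnn _) _.
  move=> s3 [[fn3 _] [_ S3]]; apply: runs_basicO => //.
  rewrite /I /= /update /= fn3 // l2; split=> //; split.
  + by rewrite (leq_trans (ltnW pk)).
  + move=> t /andP[t1 t2]; rewrite S3; case: ifP => [_|ht]; first exact: unit_piece.
    rewrite S2; apply: Iu; rewrite t2 andbT leqNgt; apply/negP => tk.
    by rewrite t1 tk in ht.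
  move=> lN.
  have S3l t : (j + l <= t < j + k)%N -> rmem s3 4 t = piece p (j + l) (j + k) t.
    by move=> ht; rewrite S3 ht.
  have [kE|kne] := eqVneq k N.
    rewrite -kE (eq_path_len p h1 S3l) -/(piece_len _ _ _) kE -kE Wk; lra.
  have kN' : (k < N)%N by rewrite ltn_neqAle kne.
  have S3r t : (j + k <= t)%N -> rmem s3 4 t = rmem s' 4 t.
    by move=> ht; rewrite S3 S2 (leqNgt (j + k)%N) in ht *; rewrite (negPf ht) andbF.
  pose u t := if (t < j + k)%N then piece p (j + l) (j + k) t else rmem s3 4 t.
  have kN2 : (j + k < j + N)%N by rewrite ltn_add2l.
  rewrite (@eq_path_len _ p _ _ (rmem s3 4) u); [|by rewrite ltn_add2l| ]; last first.
    move=> t /andP[t1 _]; rewrite /u; case: ifP => // t2.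
    by rewrite S3l // t1.
  have := @path_len_cat _ p _ _ _ u (piece p (j + l) (j + k)) (rmem s' 4) h1 kN2.
  have hu1 t : (t < j + k)%N -> u t = piece p (j + l) (j + k) t by rewrite /u => ->.
  have hu2 t : (j + k <= t)%N -> u t = rmem s' 4 t.
    by move=> ht; rewrite /u ltnNge ht /= S3r.
  move=> /(_ hu1 hu2) hcat; have hL := IL kN'.
  rewrite -/(piece_len p (j + l) (j + k)) in hcat.
  by apply: le_trans hcat _; lra.
move=> s' [F [kN Iu IL]]; rewrite /= -eqn0Ngt => /eqP e0.
rewrite e0 addn0 in Iu IL; split=> //.
by rewrite -[leRHS]subr0 -w0; apply: IL; rewrite /N; lia.
Qed.

Lemma fold_cmd_spec : exists c, forall n s j, (0 < n)%N -> nmem s 1 0 = (2 * n)%N ->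
  nmem s 7 0 = j -> (j <= 2 * n)%N ->
  runs fold_cmd s (c * (n * 1)) (fun s' => forall t,
    rmem s' 4 t = if (t < j)%N then rmem s 4 (t + 2 * n)%N else rmem s 4 t).
Proof.
eexists => n s j n0 sn sj jn.
have x0 : (0 < n * 1)%N by rewrite muln1.
apply: runs_seqO; apply: runs_basicO => //; set s1 := run _ _.
have [n1 j1 q1] : [/\ nmem s1 1 0 = (2 * n)%N, nmem s1 7 0 = j & nmem s1 11 0 = 0%N] by [].
have S1 : rmem s1 4 = rmem s 4 by [].
clearbody s1.
pose I k s' := nmem s' 11 0 = k /\ forall t,
  rmem s' 4 t = if (t < k)%N then rmem s 4 (t + 2 * n)%N else rmem s 4 t.
apply: runs_weaken (runs_whileO (I := I) jn n0 (ltnSn 0) _ _ _) (leqnn _) _.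
- by split=> // t; rewrite S1.
- move=> k s' kj [fn _] [Ik IS].
  have j' : nmem s' 7 0 = j by rewrite fn.
  have n' : nmem s' 1 0 = (2 * n)%N by rewrite fn.
  split; first by rewrite /= Ik j' addn1.
  apply: runs_basicO => //; rewrite /I /= /update /= Ik n' addn1; split=> // t.
  rewrite !IS; have -> : (k + 2 * n < k)%N = false by lia.
  by case: (ltngtP t k) => [h|h|->]; rewrite ltnS ?leqnn //; [rewrite (ltnW h) | rewrite leqNgt h].
- by move=> s' [fn _] [Ik _]; rewrite /= Ik fn // j1 addn1 ltnn.
by move=> s' [_ [_ ?]].
Qed.

Lemma average_cmd_spec : exists c, forall n s, (0 < n)%N -> nmem s 0 0 = n ->
  runs average_cmd s (c * (n * 1)) (fun s' => forall t, (t < n)%N ->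
    rmem s' 7 t = (rmem s 4 t + rmem s 4 (t + n)%N) / 2).
Proof.
eexists => n s n0 sn.
have x0 : (0 < n * 1)%N by rewrite muln1.
apply: runs_seqO; apply: runs_basicO => //; set s1 := run _ _.
have [n1 q1] : nmem s1 0 0 = n /\ nmem s1 11 0 = 0%N by [].
have S1 : rmem s1 4 = rmem s 4 by [].
clearbody s1.
pose I k s' := nmem s' 11 0 = k /\ forall t, (t < k)%N ->
  rmem s' 7 t = (rmem s 4 t + rmem s 4 (t + n)%N) / 2.
have m1 : (n <= 1 * n)%N by rewrite mul1n.
apply: runs_weaken (runs_whileO (I := I) m1 n0 (ltnSn 0) _ _ _) (leqnn _) _.
- by [].
- move=> k s' kj [fn fr] [Ik IS].
  have n' : nmem s' 0 0 = n by rewrite fn.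
  split; first by rewrite /= Ik n' addn1.
  apply: runs_basicO => //; rewrite /I /= /update /= Ik n' addn1; split=> // t.
  rewrite (fr 4%N) // S1; case: eqP => [-> //|tk]; rewrite ltnS leq_eqVlt => /predU1P[//|].
  exact: IS.
- by move=> s' [fn _] [Ik _]; rewrite /= Ik fn // n1 addn1 ltnn.
by move=> s' [_ [_ ?]].
Qed.

(** The factor 2 is there because [bound] is the length of a path of two rounds. *)
Definition good_solution p n (Z : nat -> R) (bound : R) :=
  unit_seq (cyclic n Z) /\ 2 * chain (pos p (cyclic n Z)) 0 n <= bound.

Lemma improve_cmd_spec : exists c, forall p n s j, convex_seq n p -> env p n s ->
  nmem s 7 0 = j -> (j <= 2 * n)%N -> rmem s 6 0 = 0 ->
  (forall k, (0 < k)%N -> (k <= 2 * n)%N -> dp_entry p j (rmem s 6) (nmem s 10) k) ->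
  runs improve_cmd s (c * (n * (n * 1))) (fun s' =>
    rmem s' 11 0 = rmem s 6 (2 * n)%N /\ good_solution p n (rmem s' 7) (rmem s 6 (2 * n)%N)).
Proof.
have [ct trace_ok] := trace_cmd_spec; have [cf fold_ok] := fold_cmd_spec.
have [ca average_ok] := average_cmd_spec.
exists (cost_bound (rset 11 (RGet 6 (nvar 1))) + (ct + (cf + ca)))%N => p n s j cp es sj jn w0 dps.
have n0 : (0 < n)%N by case: cp; case: (n).
have x1 : (0 < n * 1)%N by rewrite muln1.
have x0 : (0 < n * (n * 1))%N by rewrite muln_gt0 n0.
have lift c s' P Q : runs P s' (c * (n * 1)) Q -> runs P s' (c * (n * (n * 1))) Q.
  move=> h; apply: runs_weaken h _ (fun _ h => h).
  by rewrite leq_mul2l leq_pmull // orbT.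
apply: runs_seqO; apply: runs_basicO => //; set s1 := run _ _.
have es1 : env p n s1 by [].
have [j1 P1 w1] : [/\ nmem s1 7 0 = j, nmem s1 10 = nmem s 10 & rmem s1 6 = rmem s 6] by [].
have best1 : rmem s1 11 0 = rmem s 6 (2 * n)%N.
  by rewrite /s1 /= /update /=; have [_ [_ -> _]] := es.
clearbody s1; rewrite -w1 -P1 in w0 dps best1 *.
apply: runs_seqO.
apply: runs_weaken (runs_frame (trace_ok p n s1 j n0 es1 j1 jn w0 dps)) (leqnn _) _.
move=> s2 [F2 [u2 L2]]; have [fn2 fr2] := F2.
have es2 : env p n s2 by apply: env_frame F2 _ _ es1.
have j2 : nmem s2 7 0 = j by rewrite fn2.
have b2 : rmem s2 11 0 = rmem s1 6 (2 * n)%N by rewrite fr2.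
have [_ [_ n2 _]] := es2.
apply: runs_seqO; apply: (lift cf).
apply: runs_weaken (runs_frame (fold_ok n s2 j n0 n2 j2 jn)) (leqnn _) _.
move=> s3 [F3 S3]; have [fn3 fr3] := F3.
have es3 : env p n s3 by apply: env_frame F3 _ _ es2.
have [_ [n3 _ _]] := es3.
apply: (lift ca).
apply: runs_weaken (runs_frame (average_ok n s3 n0 n3)) (leqnn _) _.
move=> s4 [[fn4 fr4] Z4].
split; first by rewrite fr4 // fr3.
pose y := cyclic (2 * n) (rmem s3 4).
have py : periodic (2 * n) y by exact: cyclic_periodic.
have N0 : (0 < 2 * n)%N by lia.
have per_p : periodic n p by case: cp.
have per2 : periodic (2 * n) p by move=> t; rewrite periodic_mul.
have yS t : (j <= t < j + 2 * n)%N -> y t = rmem s2 4 t.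
  move=> /andP[t1 t2]; rewrite /y /cyclic S3.
  have [tN|tN] := ltnP t (2 * n); first by rewrite modn_small // ltnNge t1.
  have -> : (t %% (2 * n) = t - 2 * n)%N.
    by rewrite -{1}(subnK tN) modnDr modn_small //; lia.
  have -> : (t - 2 * n < j)%N by lia.
  by rewrite subnK.
have uy : unit_seq y.
  move=> t; have -> : y t = y (j + (t + (2 * n).-1 * j) %% (2 * n))%N.
    rewrite -(periodic_mod (j + _)%N py) modnDmr addnCA -mulSn prednK // mulnC.
    by rewrite addnC modnMDl (periodic_mod t py).
  have hm := ltn_pmod (t + (2 * n).-1 * j)%N N0.
  by rewrite yS; [apply: u2|]; rewrite leq_addr ltn_add2l.
have yle : chain (pos p y) 0 (2 * n) <= rmem s1 6 (2 * n)%N.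
  by apply: le_trans (close_up cp N0 per2 py yS) L2.
have Zy t : (t <= n)%N -> cyclic n (rmem s4 7) t = (y t + y (t + n)%N) / 2.
  rewrite leq_eqVlt => /predU1P[->|tn].
    rewrite /cyclic modnn Z4 // add0n addrC; congr ((_ + _) / 2).
      by rewrite /y /cyclic modn_small //; lia.
    by rewrite addnn -mul2n /y /cyclic modnn.
  rewrite /cyclic modn_small // Z4 //; congr ((_ + _) / 2).
    by rewrite /y /cyclic modn_small //; lia.
  by rewrite /y /cyclic modn_small //; lia.
split.
  move=> t; rewrite -(periodic_mod t (@cyclic_periodic _ n _)).
  rewrite Zy; last by rewrite ltnW // ltn_pmod.
  have /andP[h1 h2] := uy (t %% n)%N; have /andP[h3 h4] := uy (t %% n + n)%N.
  by apply/andP; split; lra.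
exact: le_trans (chain_average cp py Zy) yle.
Qed.

End Reconstruction.

(** One round suffices: setting parameters to 0 never creates a new 1, so implications established
    earlier persist, including the one at index 0 that depends on the last side. *)
Definition normalize_cmd : cmd :=
  Seq (Seq (rset 12 (RGet 7 (NSub (nvar 0) (NConst 1)))) (nset 11 (NConst 0)))
  (While (NLe (nsucc (nvar 11)) (nvar 0))
    (Seq (If (RLe (RConst 1) (rvar 12)) (RSet 7 (nvar 11) (RConst 0)) Skip)
    (Seq (rset 12 (RGet 7 (nvar 11))) (nset 11 (nsucc (nvar 11)))))).

(** The output overwrites the polygon. Before side [k] at most [k] points have been written, so
    cells [k] and [k + 1] still hold vertices; the last side reads cell [n], a copy of vertex 0. *)
Definition emit_cmd : cmd :=
  Seq (Seq (rset 12 (RGet 7 (NSub (nvar 0) (NConst 1))))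
      (Seq (nset 11 (NConst 0)) (nset 12 (NConst 0))))
  (Seq
    (While (NLe (nsucc (nvar 11)) (nvar 0))
      (Seq (If (RLe (RConst 1) (rvar 12)) Skip
        (Seq (RSet 0 (nvar 12)
               (edge_expr (RGet 0 (nvar 11)) (RGet 0 (nsucc (nvar 11))) (RGet 7 (nvar 11))))
        (Seq (RSet 1 (nvar 12)
               (edge_expr (RGet 1 (nvar 11)) (RGet 1 (nsucc (nvar 11))) (RGet 7 (nvar 11))))
             (nset 12 (nsucc (nvar 12))))))
      (Seq (rset 12 (RGet 7 (nvar 11))) (nset 11 (nsucc (nvar 11))))))
    (nset 0 (nvar 12))).

Definition min_inscribed_cmd : cmd :=
  Seq extend_cmd (Seq rows_cmd (Seq table_cmd (Seq search_cmd (Seq normalize_cmd emit_cmd)))).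

(** * Search, normalization, output and total time *)

Section Correctness.
Variable R : realType.
Implicit Types (s : state R) (p : nat -> R * R).
Local Open Scope ring_scope.

Lemma table_frame p n P s s' : frame P s s' -> 3%N \notin nwrites P -> 5%N \notin rwrites P ->
  table p n s -> table p n s'.
Proof.
move=> [fn fr] h3 h5 [rs ts]; split; first by rewrite /rows fn.
by move=> a b ab bn; rewrite fr // ts.
Qed.

(** At the end the stored bound is at most the value of the dynamic program for every start, so
    [closed_path_bound] applies. A one-round competitor is traversed twice for the comparison, and
    the factor 2 of [good_solution] cancels. *)
Lemma search_cmd_spec : exists c, forall p n s, convex_seq n p -> env p n s -> table p n s ->
  runs search_cmd s (c * (n * (n * (n * 1)))) (fun s' => unit_seq (cyclic n (rmem s' 7)) /\
    forall y, unit_seq y -> periodic n y ->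
      chain (pos p (cyclic n (rmem s' 7))) 0 n <= chain (pos p y) 0 n).
Proof.
have [cd dp_ok] := @dp_cmd_spec R; have [ci improve_ok] := @improve_cmd_spec R.
eexists => p n s cp es ts.
have n0 : (0 < n)%N by case: cp; case: (n).
have x1 : (0 < n * (n * 1))%N by rewrite !muln_gt0 n0.
have x0 : (0 < n * (n * (n * 1)))%N by rewrite !muln_gt0 n0.
apply: runs_seqO; apply: runs_basicO => //; set s1 := run _ _.
have [es1 ts1 j1] : [/\ env p n s1, table p n s1 & nmem s1 7 0 = 0%N] by [].
clearbody s1.
pose dominated best j := exists W : nat -> R, [/\ W j = 0,
  forall a b, (j <= a)%N -> (a < b)%N -> (b <= j + 2 * n)%N -> W b <= W a + piece_len p a b &
  best <= W (j + 2 * n)%N].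
pose I k s' := [/\ nmem s' 7 0 = k, (0 < k)%N -> good_solution p n (rmem s' 7) (rmem s' 11 0) &
  forall j, (j < k)%N -> dominated (rmem s' 11 0) j].
have m3 : ((2 * n).+1 <= 3 * n)%N by lia.
apply: runs_weaken (runs_whileO (I := I) m3 n0 x1 _ _ _) (leqnn _) _.
- by [].
- move=> k s' kn F [Ik Ig Id]; have [fn _] := F.
  have es' : env p n s' by apply: env_frame F _ _ es1.
  have ts' : table p n s' by apply: table_frame F _ _ ts1.
  have [_ [_ eN _]] := es'.
  split; first by rewrite /= Ik eN.
  apply: runs_seqO.
  apply: runs_weaken (runs_frame (dp_ok p n s' k n0 es' ts' Ik kn)) (leqnn _) _.
  move=> s2 [F2 [w2 d2]]; have [fn2 fr2] := F2.
  have es2 : env p n s2 by apply: env_frame F2 _ _ es'.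
  have k2 : nmem s2 7 0 = k by rewrite fn2.
  have b2 : rmem s2 11 0 = rmem s' 11 0 by rewrite fr2.
  have Z2 : rmem s2 7 = rmem s' 7 by rewrite fr2.
  have N2 : nmem s2 1 0 = (2 * n)%N by rewrite fn2.
  set best := rmem s2 6 (2 * n)%N.
  have dom : forall b, b <= best -> dominated b k.
    move=> b hb; exists (fun t => rmem s2 6 (t - k)%N); split.
    + by rewrite subnn.
    + move=> a c ka ac cN.
      have [|| _ _ /(_ (a - k)%N)] := d2 (c - k)%N; [lia..|].
      by rewrite !subnKC ?(leq_trans ka (ltnW ac)) //; apply; lia.
    + by rewrite addKn.
  apply: runs_seqO.
  apply: (@runs_weaken _ _ _ _ _ (fun s3 => [/\ nmem s3 7 0 = k,
      good_solution p n (rmem s3 7) (rmem s3 11 0) &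
      forall j, (j < k.+1)%N -> dominated (rmem s3 11 0) j]) _ _ (leqnn _)); last first.
    move=> s3 [k3 g3 d3]; apply: runs_basicO => //.
    by rewrite /I /= /update /= k3 addn1.
  have condE : beval s2 (BNot (BAnd (BNot (NLe (nvar 7) (NConst 0)))
      (BNot (RLe (RGet 6 (nvar 1)) (rvar 11))))) = (k == 0%N) || (best <= rmem s' 11 0).
    by rewrite /= k2 N2 b2 negb_and !negbK leqn0.
  apply: runs_ifO => //; rewrite condE => hc.
    apply: runs_weaken (runs_frame (improve_ok p n s2 k cp es2 k2 kn w2 d2)) (leqnn _) _.
    move=> s3 [[fn3 _] [b3 g3]]; split; first by rewrite fn3.
      by rewrite b3.
    move=> j; rewrite ltnS leq_eqVlt b3 => /predU1P[->|jk]; first exact: dom.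
    have [W [W0 hW hb]] := Id j jk; exists W; split=> //; apply: le_trans hb.
    by case/orP: hc => // /eqP k0; rewrite k0 in jk.
  apply: runs_basicO => //=; move: hc; rewrite negb_or -lt0n -ltNge => /andP[k0 lt].
  rewrite b2 Z2; split=> //; first exact: Ig.
  move=> j; rewrite ltnS leq_eqVlt => /predU1P[->|jk]; last exact: Id.
  exact/dom/ltW.
- by move=> s' [fn _] [Ik _ _]; rewrite /= Ik fn //; have [_ [_ -> _]] := es1; rewrite ltnn.
move=> s' [_ [_ Ig Id]]; have [uZ leZ] := Ig (ltn0Sn _); split=> // y uy py.
have py2 : periodic (2 * n) y by move=> t; rewrite periodic_mul.
have := closed_path_bound cp Id uy py2.
by rewrite (chain_double cp py) => h; have := le_trans leZ h; rewrite ler_pM2l // ltr0n.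
Qed.

Lemma normalize_cmd_spec : exists c, forall p n s, convex_seq n p -> nmem s 0 0 = n ->
  unit_seq (cyclic n (rmem s 7)) ->
  runs normalize_cmd s (c * (n * 1)) (fun s' => [/\ unit_seq (cyclic n (rmem s' 7)),
    chain (pos p (cyclic n (rmem s' 7))) 0 n <= chain (pos p (cyclic n (rmem s 7))) 0 n &
    forall t, (t < n)%N -> rmem s' 7 ((t + n).-1 %% n)%N = 1 -> rmem s' 7 t = 0]).
Proof.
eexists => p n s cp sn uZ.
have n3 : (3 <= n)%N by case: cp.
have n0 : (0 < n)%N by lia.
have x0 : (0 < n * 1)%N by rewrite muln1.
apply: runs_seqO; apply: runs_basicO => //; set s1 := run _ _.
have [n1 q1] : nmem s1 0 0 = n /\ nmem s1 11 0 = 0%N by [].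
have Z1 : rmem s1 7 = rmem s 7 by [].
have p1 : rmem s1 12 0 = rmem s 7 ((0 + n).-1 %% n)%N.
  by rewrite /s1 /= /update /= sn subn1 modn_small // prednK.
clearbody s1.
pose I k s' := [/\ nmem s' 11 0 = k, rmem s' 12 0 = rmem s' 7 ((k + n).-1 %% n)%N,
  unit_seq (cyclic n (rmem s' 7)),
  chain (pos p (cyclic n (rmem s' 7))) 0 n <= chain (pos p (cyclic n (rmem s 7))) 0 n &
  forall t, (t < k)%N -> rmem s' 7 ((t + n).-1 %% n)%N = 1 -> rmem s' 7 t = 0].
have m1 : (n <= 1 * n)%N by rewrite mul1n.
apply: runs_weaken (runs_whileO (I := I) m1 n0 (ltnSn 0) _ _ _) (leqnn _) _.
- by rewrite /I Z1 p1.
- move=> k s' kn [fn _] [Ik Ip Iu IL Inorm].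
  have n' : nmem s' 0 0 = n by rewrite fn.
  split; first by rewrite /= Ik n' addn1.
  apply: runs_basicO => //.
  rewrite run_seq [run (If _ _ _) _]/run -/run.
  have bE : beval s' (RLe (RConst 1) (rvar 12)) = (1 <= rmem s' 7 ((k + n).-1 %% n)%N).
    by rewrite /= Ip.
  have kE : ((k.+1 + n).-1 %% n)%N = k by rewrite addSn /= modnDr modn_small.
  rewrite bE; case: ifPn => hb; last first.
    rewrite /I /= /update /= Ik addn1 kE; split=> // t; rewrite ltnS leq_eqVlt => /predU1P[->|tk].
      by move=> e; rewrite e lexx in hb.
    exact: Inorm.
  have e1 : rmem s' 7 ((k + n).-1 %% n)%N = 1.
    by apply/eqP; rewrite eq_le hb andbT; case/andP: (Iu (k + n).-1).
  set s2 := run _ _.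
  have Z2 : rmem s2 7 = upd (rmem s' 7) k 0.
    by apply: boolp.funext => t; rewrite /s2 /= /update /= Ik.
  have q2 : nmem s2 11 0 = k.+1 by rewrite /s2 /= /update /= Ik addn1.
  have p2 : rmem s2 12 0 = rmem s2 7 k by rewrite /s2 /= /update /= Ik.
  rewrite /I kE p2 q2 Z2; split=> //.
  + by move=> t; rewrite /cyclic /upd; case: eqP => _; [rewrite lexx ler01 | exact: Iu].
  + exact: le_trans (chain_vertex_update cp kn e1) IL.
  move=> t; rewrite ltnS leq_eqVlt => /predU1P[->|tk]; first by rewrite /upd eqxx.
  (* If the premise concerns the cell just set to 0, it reads [0 = 1]; this happens at the
     wrap-around from the last side to index 0. *)
  rewrite {1}/upd; case: eqP => [_ e0|_ /(Inorm t tk) <-].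
    by move: (@ltr01 R); rewrite -e0 ltxx.
  by rewrite /upd ltn_eqF.
- by move=> s' [fn _] [Ik _ _ _ _]; rewrite /= Ik fn // n1 addn1 ltnn.
by move=> s' [_ [_ _ ? ? ?]].
Qed.

Lemma emit_cmd_spec : exists c, forall p n s, convex_seq n p -> env p n s ->
  runs emit_cmd s (c * (n * 1)) (fun s' =>
    output s' = kept_points n p (cyclic n (rmem s 7)) n).
Proof.
eexists => p n s cp es.
have n3 : (3 <= n)%N by case: cp.
have n0 : (0 < n)%N by lia.
have x0 : (0 < n * 1)%N by rewrite muln1.
set z := cyclic n (rmem s 7).
have [sp [en _ _]] := es.
apply: runs_seqO; apply: runs_basicO => //; set s1 := run _ _.
have [n1 q1 m1] : [/\ nmem s1 0 0 = n, nmem s1 11 0 = 0%N & nmem s1 12 0 = 0%N] by [].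
have sp1 : stores p (4 * n) s1 by [].
have Z1 : rmem s1 7 = rmem s 7 by [].
have p1 : rmem s1 12 0 = z (0 + n).-1.
  by rewrite /s1 /= /update /= /z /cyclic en subn1 modn_small // prednK.
clearbody s1.
pose E k := kept_points n p z k.
pose I k s' := [/\ nmem s' 11 0 = k, rmem s' 12 0 = z (k + n).-1,
  nmem s' 12 0 = size (E k) /\ (size (E k) <= k)%N,
  forall t, (t < size (E k))%N -> (rmem s' 0 t, rmem s' 1 t) = nth (0, 0) (E k) t &
  forall t, (k <= t <= 4 * n)%N -> (rmem s' 0 t, rmem s' 1 t) = p t].
have nn : (n <= 1 * n)%N by rewrite mul1n.
apply: runs_seqO.
apply: runs_weaken (runs_whileO (I := I) nn n0 (ltnSn 0) _ _ _) (leqnn _) _.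
- by split=> // t /andP[_ /sp1].
- move=> k s' kn [fn fr] [Ik Ip [Im mk] Iout Iin].
  have n' : nmem s' 0 0 = n by rewrite fn.
  have Z' : rmem s' 7 = rmem s 7 by rewrite fr.
  split; first by rewrite /= Ik n' addn1.
  apply: runs_basicO => //.
  have zE : z (k.+1 + n).-1 = rmem s 7 k by rewrite /z /cyclic addSn /= modnDr modn_small.
  have zk : z k = rmem s 7 k by rewrite /z /cyclic modn_small.
  rewrite run_seq [run (If _ _ _) _]/run -/run.
  have bE : beval s' (RLe (RConst 1) (rvar 12)) = ~~ kept n z k by rewrite /= Ip /kept negbK.
  rewrite bE; case kk: (kept n z k) => /=.
    have EE : E k.+1 = rcons (E k) (pos p z k) by rewrite /E kept_pointsS kk.
    have i1 : (k <= 4 * n)%N by lia.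
    have i2 : (k.+1 <= 4 * n)%N by lia.
    have x1 := Iin k; have x2 := Iin k.+1.
    rewrite leqnn leqnSn in x1 x2; move: (x1 i1) (x2 i2) => {}x1 {}x2.
    have ptE : (rmem s' 0 k + rmem s 7 k * (rmem s' 0 k.+1 - rmem s' 0 k),
        rmem s' 1 k + rmem s 7 k * (rmem s' 1 k.+1 - rmem s' 1 k)) = pos p z k.
      by rewrite /pos zk -x1 -x2.
    rewrite /I /= /update /= Ik Im Z' !addn1 EE size_rcons zE; split=> // t.
      rewrite nth_rcons; case: (ltngtP t (size (E k))) => [h|h|->] ht.
      + exact: Iout.
      + by move: h; rewrite ltnNge -ltnS ht.
      + exact: ptE.
    move=> /andP[kt t4]; have -> : (t == size (E k)) = false.
      by rewrite gtn_eqF // (leq_ltn_trans mk).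
    by apply: Iin; rewrite (ltnW kt).
  have EE : E k.+1 = E k by rewrite /E kept_pointsS kk.
  rewrite /I /= /update /= Ik Z' !addn1 EE zE; split=> //.
    by split=> //; exact: leqW.
  by move=> t /andP[kt t4]; apply: Iin; rewrite (ltnW kt).
- by move=> s' [fn _] [Ik _ _ _ _]; rewrite /= Ik fn // n1 addn1 ltnn.
move=> s' [_ [_ _ [Im _] Iout _]]; apply: runs_basicO => //.
rewrite /output /= /update /= Im.
apply: (@eq_from_nth _ (0, 0)); first by rewrite size_map size_iota.
move=> i; rewrite size_map size_iota => hi.
by rewrite (nth_map 0%N) ?size_iota // nth_iota // add0n Iout.
Qed.

Lemma min_inscribed_cmd_spec : exists c, forall C : seq (R * R),
  (5 <= size C)%N -> convex_polygon C ->
  runs min_inscribed_cmd (input C) (c * size C ^ 3) (fun s => min_perim_inscribed (output s) C).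
Proof.
have [ce extend_ok] := @extend_cmd_spec R; have [cr rows_ok] := @rows_cmd_spec R.
have [ct table_ok] := @table_cmd_spec R; have [cs search_ok] := search_cmd_spec.
have [cn normalize_ok] := normalize_cmd_spec; have [cm emit_ok] := emit_cmd_spec.
exists (ce + (cr + (ct + (cs + (cn + cm)))))%N => C n5 cC.
have cp := convex_polygon_seq cC; set p := vertex C in cp *.
set n := size C in n5 cp *.
have n0 : (0 < n)%N by lia.
have -> : (n ^ 3 = n * (n * (n * 1)))%N by rewrite !expnS.
have lift c s' P Q : runs P s' (c * (n * 1)) Q -> runs P s' (c * (n * (n * (n * 1)))) Q.
  move=> h; apply: runs_weaken h _ (fun _ h => h).
  by rewrite leq_mul2l !muln1 mulnA leq_pmull ?orbT // muln_gt0 n0.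
apply: runs_seqO; apply: (lift ce); apply: runs_weaken (extend_ok C n0) (leqnn _) _.
move=> s1 es1; apply: runs_seqO; apply: (lift cr).
apply: runs_weaken (runs_frame (rows_ok p n s1 n0 es1)) (leqnn _) _ => s2 [F2 rs2].
have es2 : env p n s2 by apply: env_frame F2 _ _ es1.
apply: runs_seqO; apply: runs_weaken (runs_frame (table_ok p n s2 n0 es2 rs2)) (leqnn _) _.
move=> s3 [F3 ts3]; have es3 : env p n s3 by apply: env_frame F3 _ _ es2.
apply: runs_seqO; apply: runs_weaken (runs_frame (search_ok p n s3 cp es3 ts3)) (leqnn _) _.
move=> s4 [F4 [u4 min4]]; have es4 : env p n s4 by apply: env_frame F4 _ _ es3.
have [_ [n4 _ _]] := es4.
apply: runs_seqO; apply: (lift cn).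
apply: runs_weaken (runs_frame (normalize_ok p n s4 cp n4 u4)) (leqnn _) _.
move=> s5 [F5 [u5 le5 norm5]]; have es5 : env p n s5 by apply: env_frame F5 _ _ es4.
apply: (lift cm); apply: runs_weaken (emit_ok p n s5 cp es5) (leqnn _) _ => s6 ->.
have pz := @cyclic_periodic _ n (rmem s5 7).
apply: optimal_output => //.
- move=> i zi.
  have := norm5 (i.+1 %% n)%N (ltn_pmod _ n0); apply.
  have -> : ((i.+1 %% n + n).-1 = i.+1 %% n + n.-1)%N by lia.
  by rewrite modnDml addSnnS prednK // modnDr.
- by move=> y uy py; apply: le_trans le5 (min4 y uy py).
Qed.

End Correctness.

Theorem mainTheorem2 (R : realType) :
  exists (P : cmd) (c : nat),
    forall (n : nat) (C : n.-tuple (R * R)),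
      5 <= n -> convex_polygon C ->
      exists (t : nat) (s : state R),
        [/\ exec P (input C) t s,
            t <= c * n ^ 3 &
            min_perim_inscribed (output s) C].
Proof.
have [c main] := @min_inscribed_cmd_spec R.
exists min_inscribed_cmd, c => n C n5 cC.
have sC : size C = n := size_tuple C.
by have := main C; rewrite sC; apply.
Qed.
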